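(* Let $(W,S)$ be a finite Coxeter system. The $f$-vector of the order complex of the shard order $(W,\leq_\sigma)$ equals the $f$-vector of the order complex of the BHZ order $(W,\leq_\beta)$; that is, for every $k\geq 1$, the number of strict chains $u_1<_\sigma\dots<_\sigma u_k$ equals the number of strict chains $u_1<_\beta\dots<_\beta u_k$.
   Context: $(W,S)$ is a finite Coxeter system with length function $\ell$. The right descent set of $w\in W$ is $D_R(w)=\{s\in S\mid \ell(ws)<\ell(w)\}$; the support $S(w)$ is the set of $s\in S$ appearing in some (equivalently any) reduced word for $w$. For $I\subseteq S$, $W_I$ is the standard parabolic subgroup generated by $I$, $W^I=\{w\in W\mid D_R(w)\cap I=\emptyset\}$, and every $w\in W$ factors uniquely as $w=w^Iw_I$ with $w^I\in W^I$, $w_I\in W_I$. Let $\Phi$ be a root system for $(W,S)$ with positive roots $\Phi^+$; $N(w)=\Phi^+\cap w(-\Phi^+)$ and $G(w)$ is the subgroup generated by $\{wsw^{-1}\mid s\in D_R(w)\}$. Shard order: $u\leq_\sigma v$ iff $N(u)\subseteq N(v)$ and $G(u)\subseteq G(v)$. BHZ order: $u\leq_\beta v$ iff $v_{S(u)}=u$. The order complex of a finite poset is the simplicial complex whose faces are the nonempty totally ordered subsets (strict chains); its $f$-vector records the number of faces of each dimension. *)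

(* Defs.v *)
From HB Require Import structures.
From mathcomp Require Import all_boot all_order all_fingroup all_algebra.
From mathcomp Require Import mxrepresentation.
From mathcomp Require Import boolp reals.

Set Implicit Arguments.
Unset Strict Implicit.
Unset Printing Implicit Defensive.

Import Order.TTheory GRing.Theory Num.Theory.

Section CoxeterSystem.
Local Open Scope group_scope.
Variables (gT : finGroupType) (S : {set gT}).
Implicit Types (I : {set gT}) (s u v w : gT).

(* The group W is the whole of gT. Following Bourbaki (Lie, Ch. IV, 1.3), the
   presentation <S | (st)^m(s,t) = 1> with m(s,t) the order of st is expressed
   by its universal property among all groups, finite or not. Only the values
   of f on S matter. *)
Definition coxeter_system : Prop :=
  [/\ <<S>> = [set: gT],
      {in S, forall s, #[s] = 2%N} &
      forall (H : groupType) (f : gT -> H),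
        {in S &, forall s t, (f s * f t) ^+ #[s * t] = 1} ->
        exists2 phi : gT -> H,
          {morph phi : x y / x * y} & {in S, phi =1 f}].

(* S ^+ n is the n-fold product set, i.e., the set of values of words of
   length n in S. *)
Lemma ex_word w : exists n, (w \in S ^+ n) || (w \notin <<S>>).
Proof.
have [Sw|_] := boolP (w \in <<S>>); last by exists 0%N; rewrite orbT.
have [n [c Sc ->]] := gen_prodgP Sw; exists n; rewrite orbF.
have -> : S ^+ n = \prod_(i < n) S by rewrite prodg_const card_ord.
by apply/prodsgP; exists c => // i _; apply: Sc.
Qed.

(* When S generates W the second disjunct of ex_word is void, and this is the
   least n such that w is the value of a word of length n. *)
Definition length w : nat := ex_minn (ex_word w).

Definition reduced_word w (t : seq gT) : bool :=
  [&& all (mem S) t, size t == length w & \prod_(x <- t) x == w].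

Definition descR w : {set gT} := [set s in S | (length (w * s) < length w)%N].

Definition support w : {set gT} :=
  [set s | [exists t : (length w).-tuple gT, reduced_word w t && (s \in t)]].

(* The set W^I of minimal coset representatives; W_I is <<I>>. *)
Definition min_reps I : {set gT} := [set w | descR w :&: I == set0].

(* The component w_I of the factorization w = w^I w_I, where
   w^I = w (w_I)^-1. *)
Definition parabolic_part I w : gT :=
  odflt 1 [pick u in <<I>> | w * u^-1 \in min_reps I].

Definition bhz_le : rel gT := fun u v => parabolic_part (support u) v == u.

Definition descent_group w : {set gT} := <<[set w * s * w^-1 | s in descR w]>>.

End CoxeterSystem.

Section RootSystem.
Local Open Scope ring_scope.
Variables (R : realType) (gT : finGroupType) (S : {set gT}) (n : nat).
Variable rG : mx_representation R [set: gT]%G n.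
Implicit Types (Phi : seq 'cV[R]_n) (alpha : gT -> 'cV[R]_n).

Definition dot (u v : 'cV[R]_n) : R := \sum_(i < n) u i 0 * v i 0.

Definition reflection (a v : 'cV[R]_n) : 'cV[R]_n :=
  v - (2 * dot v a / dot a a) *: a.

Definition nonneg_comb alpha (b : 'cV[R]_n) : Prop :=
  exists2 c : gT -> R,
    {in S, forall s, 0 <= c s} & b = \sum_(s in S) c s *: alpha s.

(* Phi is a (reduced, not necessarily crystallographic or essential) root
   system in Euclidean space R^n, as in Humphreys, Reflection Groups and
   Coxeter Groups, 1.2-1.3. The group W acts faithfully on column vectors on
   the left by v |-> rG w *m v, each s in S acting as the reflection in the
   simple root alpha s. *)
Record root_system Phi alpha : Prop := RootSystem {
  root_neq0 : 0 \notin Phi;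
  root_scale : {in Phi, forall a (c : R),
    (c *: a \in Phi) = (c == 1) || (c == -1)};
  root_reflection : {in Phi &, forall a b, reflection a b \in Phi};
  root_faithful : mx_faithful rG;
  simple_root : {in S, forall s, alpha s \in Phi};
  simple_reflection : {in S, forall s v, rG s *m v = reflection (alpha s) v};
  simple_free : free [seq alpha s | s <- enum S];
  root_sign : {in Phi, forall b, nonneg_comb alpha b \/ nonneg_comb alpha (- b)}
}.

Definition positive_roots Phi alpha : seq 'cV[R]_n :=
  [seq b <- Phi | `[< nonneg_comb alpha b >]].

Definition inversions Phi alpha (w : gT) : seq 'cV[R]_n :=
  [seq b <- positive_roots Phi alpha |
     b \in [seq rG w *m (- g) | g <- positive_roots Phi alpha]].

Definition shard_le Phi alpha : rel gT := fun u v =>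
  all (mem (inversions Phi alpha v)) (inversions Phi alpha u)
    && (descent_group S u \subset descent_group S v).

End RootSystem.

Section OrderComplex.
Variables (T : finType) (le : rel T).

Definition order_complex : {set {set T}} :=
  [set A : {set T} | (A != set0) &&
     [forall x in A, forall y in A, le x y || le y x]].

(* Number of faces of dimension i, i.e., with i + 1 vertices. *)
Definition fvector (i : nat) : nat :=
  #|[set A in order_complex | #|A| == i.+1]|.

Definition strict : rel T := fun x y => (x != y) && le x y.

(* Number of chains u_1 < ... < u_k. *)
Definition num_chains (k : nat) : nat :=
  #|[set t : k.-tuple T | sorted strict t]|.

End OrderComplex.

(* Main.v *)
(* Write D(w) for the right descent set and say that the walls of w are the
   roots w a_s, s in D(w). The key point is that, for J = D(v), the map sending
   u to its projection y on the coset v W_J (the element of v W_J having the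
   same inversions as u among the roots of v W_J v^-1) is a bijection from the
   lower interval of v in the shard order to v W_J, under which D(u) and
   D(y) :&: J are conjugate. Hence the number of shard chains with top v depends
   only on D(v), and all chains are counted by iterating the kernel
   d(K,L) = #{x in W_L | D(x) = K}. In the BHZ order the elements above u are the
   a u with a in W^J, J = S(u), and their support is S(a) U J, so chains are
   counted by iterating f(J,K) = #{a in W^J | S(a) U J = K}. Multiplication by the
   longest element of W_J gives zeta d = f zeta for the zeta function of the
   Boolean lattice, and this intertwining makes the two totals equal. *)

From mathcomp Require Import all_boot all_order all_fingroup all_algebra.
From mathcomp Require Import mxrepresentation.
From mathcomp Require Import boolp reals ring.
(* Imported last, so that [support] is not the one of ssralg. *)
Require Import Defs.

Set Implicit Arguments.
Unset Strict Implicit.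
Unset Printing Implicit Defensive.

Import Order.TTheory GRing.Theory Num.Theory.

Lemma count_lt (T : eqType) (a1 a2 : pred T) (r : seq T) x :
  {in r, subpred a1 a2} -> x \in r -> ~~ a1 x -> a2 x -> (count a1 r < count a2 r)%N.
Proof.
move=> a12 rx n1x a2x; have /eq_in_count-> : {in r, a1 =1 predI a1 a2}.
  by move=> y ry /=; apply/idP/andP => [a1y|[]//]; split=> //; apply: a12.
rewrite -count_filter -[X in (_ < X)%N]size_filter ltn_neqAle count_size andbT -all_count.
by apply/allPn; exists x; rewrite ?mem_filter ?a2x.
Qed.

(** * Strict iterated kernels and their zeta transforms *)

Section IteratedKernel.
Variables (T : finType) (P : pred T).
Implicit Types (M : T -> T -> nat) (a c : T -> nat).

(** The diagonal is left out so that, for [M] an order relation, the [k]-th iterate on the constant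
    1 counts the strict chains with [k] further elements starting at [x]. *)
Definition kernel_step M c x := \sum_(y | P y && (y != x)) M x y * c y.

Lemma eq_kernel_step M c c' x : (forall y, P y -> c y = c' y) ->
  kernel_step M c x = kernel_step M c' x.
Proof. by move=> eq_c; apply: eq_bigr => y /andP[Py _]; rewrite eq_c. Qed.

Lemma kernel_step_adjoint M a c :
  \sum_(x | P x) kernel_step (fun x y => M y x) a x * c x =
  \sum_(x | P x) a x * kernel_step M c x.
Proof.
under eq_bigr do rewrite big_distrl /=; under [RHS]eq_bigr do rewrite big_distrr /=.
rewrite (exchange_big_dep P) //= => [|x y _ /andP[]//].
apply: eq_bigr => y Py; apply: eq_big => [x|x _]; first by rewrite Py eq_sym.
by rewrite -mulnA mulnCA mulnA.
Qed.

(** A kernel and its transpose are adjoint for the pairing of functions on [P]. For an order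
    relation this lets chains be read from either end. *)
Lemma iter_kernel_adjoint k M a c :
  \sum_(x | P x) iter k (kernel_step (fun x y => M y x)) a x * c x =
  \sum_(x | P x) a x * iter k (kernel_step M) c x.
Proof. by elim: k a => // k IHk a; rewrite iterSr IHk /= -kernel_step_adjoint. Qed.

Variables (le : rel T) (d f : T -> T -> nat) (bot top : T).
Hypotheses (le_refl : reflexive le) (Pbot : P bot) (Ptop : P top).
Hypotheses (le_bot : forall x, P x -> le bot x) (le_top : forall x, P x -> le x top).
Hypothesis zeta_df : forall x z, P x -> P z ->
  \sum_(y | P y && le x y) d y z = \sum_(y | P y && le y z) f x y.
Hypotheses (d_diag : forall x, P x -> d x x = 1) (f_diag : forall x, P x -> f x x = 1).

Let zeta c x := \sum_(y | P y && le x y) c y.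
Let H k := iter k (kernel_step f) (fun=> 1).

(** If [le x z], the term [y = z] on the left of [zeta_df] and the term [y = x] on the right are
    both 1 and cancel. Otherwise neither term occurs. *)
Lemma zeta_df_strict x z : P x -> P z ->
  \sum_(y | [&& P y, le x y & y != z]) d y z = \sum_(y | [&& P y, le y z & y != x]) f x y.
Proof.
move=> Px Pz; have := zeta_df Px Pz; have [xz|nxz] := boolP (le x z).
  rewrite (bigD1 z) ?Pz //= [RHS](bigD1 x) ?Px //= d_diag // f_diag // => -[].
  by under eq_bigl do rewrite -andbA; under [RHS]eq_bigl do rewrite -andbA.
rewrite (eq_bigl (fun y => [&& P y, le x y & y != z])) => [->|y]; last first.
  by rewrite andbA; case: eqP => [->|]; rewrite ?andbT // (negbTE nxz) andbF.
apply: eq_bigl => y; rewrite andbA.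
by case: eqP => [->|]; rewrite ?andbT // (negbTE nxz) andbF.
Qed.

(* zeta d' = f' zeta, for d' and f' the strict parts of d and f. *)
Lemma zeta_kernel_step c x : P x ->
  zeta (kernel_step d c) x = kernel_step f (zeta c) x.
Proof.
move=> Px; rewrite /zeta /kernel_step.
rewrite (exchange_big_dep P) /= => [|y z _ /andP[]//].
under [RHS]eq_bigr do rewrite big_distrr /=.
rewrite [RHS](exchange_big_dep P) /= => [|y z _ /andP[]//].
apply: eq_bigr => z Pz; rewrite -!big_distrl /=; congr (_ * _).
transitivity (\sum_(y | [&& P y, le x y & y != z]) d y z).
  by apply: eq_bigl => y; rewrite Pz /= [z == y]eq_sym andbA.
rewrite zeta_df_strict //; apply: eq_bigl => y.
by rewrite Pz /= -andbA [le y z && _]andbC.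
Qed.

(** By adjointness the left side is the zeta transform at [bot] of the iterated strict kernel of [d]
    applied to the column [d^~ top]. Zeta carries the strict part of [d] to that of [f], and takes
    the column itself to the row sums of [f], because everything lies below [top]. The diagonal of
    [f] splits each row sum into two consecutive iterates [H]. *)
Lemma iter_kernel_total k :
  \sum_(x | P x) d x top * iter k (kernel_step (fun x y => d y x)) (fun=> 1) x =
  \sum_(x | P x) f bot x * H k x.
Proof.
have total_H j x : P x -> \sum_(y | P y) f x y * H j y = H j x + H j.+1 x.
  move=> Px; rewrite (bigD1 x) //= f_diag // mul1n; congr (_ + _).
have zeta_iter j x : P x -> zeta (iter j (kernel_step d) (d^~ top)) x = H j x + H j.+1 x.
  elim: j x => [|j IHj] x Px.
    rewrite -total_H // /zeta zeta_df //.
    by apply: eq_big => [y|y _]; [rewrite andb_idr // => /le_top|rewrite muln1].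
  rewrite iterS zeta_kernel_step // (eq_kernel_step _ _ IHj) {IHj}.
  rewrite /kernel_step; under eq_bigr do rewrite mulnDr.
  by rewrite big_split.
under eq_bigr do rewrite mulnC; rewrite iter_kernel_adjoint.
under eq_bigr do rewrite mul1n.
rewrite total_H // -zeta_iter // /zeta; apply: eq_bigl => y.
by rewrite andb_idr // => /le_bot.
Qed.

End IteratedKernel.

(** * Words and length *)

Section Words.
Local Open Scope group_scope.
Variables (gT : finGroupType) (S : {set gT}).
Implicit Types (s w : gT) (t : seq gT).

Lemma expgs_wordP n w :
  reflect (exists t, [/\ all (mem S) t, size t = n & \prod_(x <- t) x = w])
          (w \in S ^+ n).
Proof.
elim: n w => [|n IHn] w.
  rewrite expg0; apply: (iffP set1gP) => [->|].
    by exists [::]; rewrite big_nil.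
  by case=> -[|x t] [_ // _ <-]; rewrite big_nil.
rewrite expgS; apply: (iffP mulsgP) => [[x y Sx /IHn[t [St <- <-]] ->]|].
  by exists (x :: t); rewrite /= big_cons St andbT.
case=> -[|x t] []//= /andP[Sx St] [size_t] <-.
by rewrite big_cons; exists x (\prod_(i <- t) i) => //; apply/IHn; exists t.
Qed.

Lemma length_word t : all (mem S) t -> (length S (\prod_(x <- t) x) <= size t)%N.
Proof.
move=> St; rewrite /length; case: ex_minnP => m _; apply.
by apply/orP; left; apply/expgs_wordP; exists t.
Qed.

Hypothesis generatedS : <<S>> = [set: gT].

Lemma ex_reduced_word w : exists t, reduced_word S w t.
Proof.
have : w \in S ^+ length S w.
  by rewrite /length; case: ex_minnP => m; rewrite generatedS in_setT orbF.
by case/expgs_wordP=> t [St sz_t w_t]; exists t; rewrite /reduced_word St sz_t w_t !eqxx.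
Qed.

End Words.

(** * Roots and parabolic subgroups *)

Section RootGeometry.
Local Open Scope ring_scope.
Variables (R : realType) (gT : finGroupType) (S : {set gT}) (n : nat).
Variable rG : mx_representation R [set: gT]%G n.
Variables (Phi : seq 'cV[R]_n) (alpha : gT -> 'cV[R]_n).
Hypothesis generatedS : <<S>>%g = [set: gT].
Hypothesis rootPhi : root_system S rG Phi alpha.
Implicit Types (s t u v w y : gT) (b c : 'cV[R]_n) (I J K : {set gT}).

Notation "w ** b" := (rG w *m b) (at level 35, right associativity).

Lemma act1 b : 1%g ** b = b.
Proof. by rewrite repr_mx1 mul1mx. Qed.

Lemma actM u v b : (u * v)%g ** b = u ** v ** b.
Proof. by rewrite repr_mxM ?inE // mulmxA. Qed.

Lemma actK u b : u^-1%g ** u ** b = b.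
Proof. by rewrite -actM mulVg act1. Qed.

Lemma actKV u b : u ** u^-1%g ** b = b.
Proof. by rewrite -actM mulgV act1. Qed.

Lemma act_sum w (I : finType) (P : pred I) (c : I -> R) (b : I -> 'cV[R]_n) :
  w ** (\sum_(i | P i) c i *: b i) = \sum_(i | P i) c i *: (w ** b i).
Proof. by rewrite mulmx_sumr; apply: eq_bigr => i _; rewrite -scalemxAr. Qed.

Lemma dotDl a b c : dot (a + b) c = dot a c + dot b c.
Proof. by rewrite -big_split; apply: eq_bigr => i _; rewrite mxE mulrDl. Qed.

Lemma dotC b c : dot b c = dot c b.
Proof. by apply: eq_bigr => i _; rewrite mulrC. Qed.

Lemma dotZl (k : R) b c : dot (k *: b) c = k * dot b c.
Proof. by rewrite mulr_sumr; apply: eq_bigr => i _; rewrite mxE mulrA. Qed.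

Lemma dotBl a b c : dot (a - b) c = dot a c - dot b c.
Proof. by rewrite dotDl -scaleN1r dotZl mulN1r. Qed.

Lemma dot_eq0 b : (dot b b == 0) = (b == 0).
Proof.
rewrite psumr_eq0 => [|i _]; last exact: sqr_ge0.
apply/allP/eqP => [b0|-> i _]; last by rewrite mxE mul0r eqxx.
apply/colP => i; apply/eqP; rewrite mxE -[_ == _]orbb -mulf_eq0.
exact: b0 (mem_index_enum i).
Qed.

Lemma alpha_neq0 s : s \in S -> alpha s != 0.
Proof.
move=> Ss; apply: contraNneq (root_neq0 rootPhi) => <-.
exact: simple_root rootPhi s Ss.
Qed.

Lemma act_simpleE s b : s \in S ->
  s ** b = b - (2 * dot b (alpha s) / dot (alpha s) (alpha s)) *: alpha s.
Proof. by move=> Ss; rewrite (simple_reflection rootPhi). Qed.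

Lemma act_alpha s : s \in S -> s ** alpha s = - alpha s.
Proof.
move=> Ss; rewrite act_simpleE // mulfK ?dot_eq0 ?alpha_neq0 //.
by rewrite scaler_nat mulr2n opprD addrA subrr add0r.
Qed.

Lemma gen_ind J (P : gT -> Prop) :
  P 1%g -> (forall s w, s \in J -> P w -> P (s * w)%g) ->
  forall w, w \in <<J>>%g -> P w.
Proof.
move=> P1 PM w /gen_prodgP[m [c Jc ->]].
elim: m c Jc => [|m IHm] c Jc; first by rewrite big_ord0.
by rewrite big_ord_recl; apply: PM => //; apply: IHm => i; apply: Jc.
Qed.

Lemma weyl_ind (P : gT -> Prop) :
  P 1%g -> (forall s w, s \in S -> P w -> P (s * w)%g) -> forall w, P w.
Proof. by move=> P1 PM w; apply: (gen_ind P1 PM); rewrite generatedS inE. Qed.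

Lemma dot_act w b c : dot (w ** b) (w ** c) = dot b c.
Proof.
elim/weyl_ind: w b c => [|s w Ss IHw] b c; first by rewrite !act1.
rewrite !actM -[RHS]IHw; move: (w ** b) (w ** c) => {}b {}c.
have a0 : dot (alpha s) (alpha s) != 0 by rewrite dot_eq0 alpha_neq0.
rewrite !act_simpleE // !dotBl !dotZl (dotC b (_ - _)) (dotC (alpha s) (_ - _)).
rewrite !dotBl !dotZl (dotC c b) (dotC (alpha s) b); move: a0.
move: (dot (alpha s) _) (dot b _) (dot c _) (dot b _) => p q r q'.
by move=> p0; field.
Qed.

(** [coord] takes a position in the family of simple roots, here that of [s] in [enum S]; outside
    [S] the value is 0. The result is linear in [b] on the whole space. *)
Definition simple_coord s b : R :=
  if insub (index s (enum S)) is Some i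
  then coord (in_tuple [seq alpha s | s <- enum S]) i b else 0.

Local Notation cf := simple_coord.

Lemma coord_sum s (I : finType) (P : pred I) (k : I -> R) (b : I -> 'cV[R]_n) :
  cf s (\sum_(i | P i) k i *: b i) = \sum_(i | P i) k i * cf s (b i).
Proof.
rewrite /cf; case: insub => [j|]; last by rewrite big1 // => i _; rewrite mulr0.
by rewrite linear_sum; apply: eq_bigr => i _; rewrite linearZ.
Qed.

Lemma coordN s b : cf s (- b) = - cf s b.
Proof. by rewrite /cf; case: insub => [j|]; rewrite ?oppr0 // linearN. Qed.

Lemma coordBZ s b (k : R) c : cf s (b - k *: c) = cf s b - k * cf s c.
Proof.
by rewrite /cf; case: insub => [j|]; rewrite ?mulr0 ?subr0 // linearB linearZ.
Qed.

Lemma coord_alpha s t : s \in S -> t \in S -> cf s (alpha t) = (s == t)%:R.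
Proof.
move=> Ss St; rewrite /cf.
have lt_index u : u \in S -> (index u (enum S) < size [seq alpha s | s <- enum S])%N.
  by move=> Su; rewrite size_map index_mem mem_enum.
case: insubP => [i _ i_s|]; last by rewrite lt_index.
have -> : alpha t = (in_tuple [seq alpha s | s <- enum S])`_(Ordinal (lt_index t St)).
  by rewrite /= (nth_map s) ?index_mem ?mem_enum // nth_index ?mem_enum.
rewrite coord_free ?(simple_free rootPhi) // -val_eqE /= i_s eq_sym; congr (nat_of_bool _)%:R.
have [->|ne_st] := eqVneq s t; first by rewrite eqxx.
apply: contra_neqF ne_st => /eqP /(congr1 (nth s (enum S))).
by rewrite !nth_index ?mem_enum.
Qed.

(** A boolean form of [nonneg_comb], to be used on roots, where the two agree. *)
Definition pos b : bool := [forall s in S, 0 <= cf s b].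

Lemma posP b : reflect {in S, forall s, 0 <= cf s b} (pos b).
Proof. exact: forall_inP. Qed.

Lemma nonneg_comb_coord b : nonneg_comb S alpha b ->
  b = \sum_(s in S) cf s b *: alpha s /\ pos b.
Proof.
case=> k k_ge0 b_k; have cf_k s : s \in S -> cf s b = k s.
  move=> Ss; rewrite b_k coord_sum (bigD1 s) //= coord_alpha // eqxx mulr1.
  rewrite big1 ?addr0 // => t /andP[St ne_ts].
  by rewrite coord_alpha // eq_sym (negbTE ne_ts) mulr0.
split; first by rewrite {1}b_k; apply: eq_bigr => s Ss; rewrite cf_k.
by apply/posP => s Ss; rewrite cf_k // k_ge0.
Qed.

Lemma root_coord b : b \in Phi -> b = \sum_(s in S) cf s b *: alpha s.
Proof.
case/(root_sign rootPhi) => /nonneg_comb_coord[] // /(congr1 -%R) b_def _.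
rewrite opprK in b_def; rewrite {1}b_def -sumrN; apply: eq_bigr => s _.
by rewrite coordN scaleNr opprK.
Qed.

Lemma rootN b : b \in Phi -> - b \in Phi.
Proof. by move=> Pb; rewrite -scaleN1r (root_scale rootPhi) // eqxx orbT. Qed.

Lemma posN b : b \in Phi -> pos (- b) = ~~ pos b.
Proof.
move=> Pb; have b0 : ~~ (pos b && pos (- b)).
  apply: contra (root_neq0 rootPhi) => /andP[/posP pb /posP nb].
  suff <- : b = 0 by [].
  rewrite (root_coord Pb) big1 // => s Ss; have := nb s Ss; have := pb s Ss.
  rewrite coordN oppr_ge0 => b_ge0 b_le0.
  by have /eqP-> : cf s b == 0 by [rewrite eq_le b_ge0 b_le0]; rewrite scale0r.
by have [/nonneg_comb_coord[_ pb]|/nonneg_comb_coord[_ pb]] := root_sign rootPhi Pb;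
  move: b0; rewrite pb /= ?andbT => /negbTE->.
Qed.

Lemma nonneg_combE b : b \in Phi -> `[< nonneg_comb S alpha b >] = pos b.
Proof.
move=> Pb; apply/asboolP/idP => [/nonneg_comb_coord[]//|/posP pb].
by exists (fun s => cf s b); [|exact: root_coord].
Qed.

Lemma act_root w b : b \in Phi -> w ** b \in Phi.
Proof.
elim/weyl_ind: w b => [|s w Ss IHw] b Pb; first by rewrite act1.
rewrite actM (simple_reflection rootPhi) //.
by apply: (root_reflection rootPhi); [exact: simple_root rootPhi s Ss|exact: IHw].
Qed.

Lemma alpha_root s : s \in S -> alpha s \in Phi.
Proof. exact: (simple_root rootPhi). Qed.

Lemma pos_alpha s : s \in S -> pos (alpha s).
Proof. by move=> Ss; apply/posP => t St; rewrite coord_alpha // ler0n. Qed.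

Lemma actN w b : w ** (- b) = - (w ** b).
Proof. by rewrite mulmxN. Qed.

Lemma pos_eq_alpha r b : b \in Phi -> pos b -> r \in S ->
  (forall s, s \in S -> s != r -> cf s b = 0) -> b = alpha r.
Proof.
move=> Pb pb Sr b0; have b_r : b = cf r b *: alpha r.
  rewrite {1}(root_coord Pb) (bigD1 r) //= big1 ?addr0 // => s /andP[Ss ne_sr].
  by rewrite b0 // scale0r.
have := Pb; rewrite b_r (root_scale rootPhi) ?alpha_root //.
case/orP=> /eqP cr1; first by rewrite cr1 scale1r.
by have /posP/(_ r Sr) := pb; rewrite cr1 ler0N1.
Qed.

Lemma coord_act_simple s t b : s \in S -> t != s -> cf t (s ** b) = cf t b.
Proof.
move=> Ss ne_ts; rewrite act_simpleE // coordBZ.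
have [St|nSt] := boolP (t \in S).
  by rewrite coord_alpha // (negbTE ne_ts) mulr0 subr0.
rewrite /cf; case: insubP => [i lt_i _|_]; last by rewrite mulr0 subr0.
by case/negP: nSt; rewrite -(mem_enum S) -index_mem -(size_map alpha).
Qed.

(** The reflection [s] changes only the coordinate at [s]. If it makes a positive root negative, all
    other coordinates vanish and the root is [alpha s]. *)
Lemma act_simple_pos s b : s \in S -> b \in Phi -> pos b -> b != alpha s ->
  pos (s ** b).
Proof.
move=> Ss Pb pb; apply: contra_neqT; rewrite -posN ?act_root // => /posP nsb.
apply: pos_eq_alpha => // t St ne_ts; apply: le_anti; apply/andP; split.
  by have := nsb t St; rewrite coordN oppr_ge0 coord_act_simple.
exact: (posP _ pb).
Qed.

Lemma act_inj u v : (forall b, u ** b = v ** b) -> u = v.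
Proof.
move=> eq_uv; apply: (mx_faithful_inj (root_faithful rootPhi)); rewrite ?inE //.
apply/matrixP => i j; have /(congr1 (fun M : 'cV[R]_n => M i 0)) := eq_uv (delta_mx j 0).
by rewrite -!colE !mxE.
Qed.

Lemma conj_simple s t g : s \in S -> t \in S -> g ** alpha s = alpha t ->
  (g * s * g^-1)%g = t.
Proof.
move=> Ss St gs; apply: act_inj => b.
rewrite !actM (act_simpleE _ Ss) (act_simpleE _ St) mulmxBr actKV -scalemxAr gs.
by rewrite -!gs dot_act -[dot (_ ** b) _](dot_act g) actKV.
Qed.

Lemma simple_sqr s : s \in S -> (s * s)%g = 1%g.
Proof.
move=> Ss; apply: act_inj => b.
rewrite actM act1 [s ** b]act_simpleE // mulmxBr -scalemxAr act_alpha //.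
by rewrite (act_simpleE _ Ss) scalerN opprK subrK.
Qed.

Lemma simple_inv s : s \in S -> s^-1%g = s.
Proof. by move=> Ss; apply/eqP; rewrite eq_invg_mul simple_sqr. Qed.

(** Applying the word to [alpha s] from the right, some letter [a] turns a positive root
    [p ** alpha s] negative. That root is then [alpha a], so [a p = p s], and this letter can be
    deleted at the cost of a final [s]. *)
Lemma exchange (t : seq gT) s : all (mem S) t -> s \in S ->
  ~~ pos ((\prod_(x <- t) x)%g ** alpha s) ->
  exists t' : seq gT, [/\ all (mem S) t', (size t').+1 = size t
                & (\prod_(x <- t') x = \prod_(x <- t) x * s)%g].
Proof.
elim: t => [|a t IHt] /=; first by move=> _ Ss; rewrite big_nil act1 pos_alpha.
case/andP=> Sa St Ss; rewrite big_cons actM.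
set p := (\prod_(x <- t) x)%g in IHt *; have [pb|nb] := boolP (pos (p ** alpha s)).
  move=> nab; exists t; split=> //; rewrite -/p.
  have /(conj_simple Ss Sa) a_def : p ** alpha s = alpha a.
    apply: contraNeq nab; apply: act_simple_pos => //.
    by rewrite act_root ?alpha_root.
  by rewrite -a_def mulgKV -mulgA simple_sqr // mulg1.
have [t' [St' sz_t' p_t']] := IHt St Ss nb => _.
exists (a :: t'); rewrite /= big_cons p_t' mulgA sz_t' St'; split=> //.
by rewrite andbT.
Qed.

(** If [w ** alpha s] is negative, exchange shortens a reduced word of [w]. If it is positive, the
    same argument applied to [w * s] shows that [w] is the shorter of the two. *)
Lemma descR_root w s : (s \in descR S w) = (s \in S) && ~~ pos (w ** alpha s).
Proof.
rewrite inE; case Ss: (s \in S) => //=.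
have len_lt u : ~~ pos (u ** alpha s) -> (length S (u * s)%g < length S u)%N.
  have [t /and3P[St /eqP<- /eqP <-]] := ex_reduced_word generatedS u.
  case/(exchange St Ss) => t' [St' <- <-]; rewrite ltnS; exact: length_word.
apply/idP/idP; last exact: len_lt.
apply: contraTN => pws; rewrite -leqNgt ltnW //.
have {1}-> : w = (w * s * s)%g by rewrite -mulgA simple_sqr // mulg1.
by apply: len_lt; rewrite actM act_alpha // actN posN ?negbK // act_root ?alpha_root.
Qed.

Lemma descR_subS w : descR S w \subset S.
Proof. by apply/subsetP => s; rewrite inE => /andP[]. Qed.

Lemma ex_descR w : w != 1%g -> exists s, s \in descR S w.
Proof.
have [t /and3P[St /eqP sz_t /eqP w_t]] := ex_reduced_word generatedS w.
case/lastP: t St sz_t w_t => [|t s]; first by rewrite big_nil => _ _ ->; rewrite eqxx.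
rewrite all_rcons size_rcons => /andP[/= Ss St] sz_t w_t _; exists s.
rewrite inE Ss -sz_t ltnS -w_t big_rcons /= -mulgA simple_sqr // mulg1.
exact: length_word.
Qed.

Lemma coord_neg b s : b \in Phi -> ~~ pos b -> s \in S -> cf s b <= 0.
Proof.
by move=> Pb; rewrite -posN // => /posP nb Ss; rewrite -oppr_ge0 -coordN nb.
Qed.

Lemma coord_gt0_pos b s : b \in Phi -> s \in S -> 0 < cf s b -> pos b.
Proof.
by move=> Pb Ss; apply: contraTT => nb; rewrite -leNgt coord_neg.
Qed.

(** * Parabolic subgroups, their root subsystems and minimal representatives *)

Definition spanned J b : bool := [forall s in S :\: J, cf s b == 0].

Lemma spannedP J b : reflect {in S, forall s, s \notin J -> cf s b = 0} (spanned J b).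
Proof.
apply: (iffP forall_inP) => b0 s; first by move=> Ss nJs; apply/eqP/b0; rewrite inE nJs.
by case/setDP=> Ss nJs; rewrite b0.
Qed.

Lemma spannedN J b : spanned J (- b) = spanned J b.
Proof. by apply: eq_forallb => s; rewrite coordN oppr_eq0. Qed.

Lemma spanned_alpha J s : J \subset S -> s \in J -> spanned J (alpha s).
Proof.
move=> /subsetP sJS Js; apply/spannedP => t St nJt.
rewrite coord_alpha ?(sJS s) //; suff /negbTE-> : t != s by [].
by apply: contraNneq nJt => ->.
Qed.

Lemma spanned_sum J b : J \subset S -> b \in Phi -> spanned J b ->
  b = \sum_(s in J) cf s b *: alpha s.
Proof.
move=> sJS Pb /spannedP b0; rewrite {1}(root_coord Pb) (big_setID J) /=.
rewrite (setIidPr sJS) [X in _ + X]big1 ?addr0 // => s /setDP[Ss nJs].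
by rewrite b0 // scale0r.
Qed.

Lemma coord_parabolic J w t b : J \subset S -> w \in <<J>>%g -> t \notin J ->
  cf t (w ** b) = cf t b.
Proof.
move=> /subsetP sJS Jw nJt; elim/gen_ind: Jw b => [|s {}w Js IHw] b; first by rewrite act1.
by rewrite actM coord_act_simple ?sJS //; apply: contraNneq nJt => ->.
Qed.

Lemma spanned_parabolic J w b : J \subset S -> w \in <<J>>%g ->
  spanned J (w ** b) = spanned J b.
Proof.
move=> sJS Jw; apply: eq_forallb => s; case: setDP => //= -[_ nJs].
by rewrite (coord_parabolic _ sJS).
Qed.

(** W_J fixes every coordinate outside [J], and a single nonzero coordinate decides the sign of a
    root. *)
Lemma pos_parabolic J w b : J \subset S -> w \in <<J>>%g -> b \in Phi ->
  ~~ spanned J b -> pos (w ** b) = pos b.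
Proof.
move=> sJS Jw Pb /forall_inPn[t /setDP[St nJt] t_neq0].
have cf_t := coord_parabolic b sJS Jw nJt.
case: (ltgtP (cf t b) 0) t_neq0 => // [t_lt0|t_gt0] _.
  have negP c : c \in Phi -> cf t c < 0 -> pos c = false.
    by move=> Pc; apply: contraTF => /posP/(_ t St); rewrite -leNgt.
  by rewrite !negP ?cf_t ?act_root.
by rewrite !(@coord_gt0_pos _ t) ?cf_t ?act_root.
Qed.

Lemma descR_parabolic J x : J \subset S -> x \in <<J>>%g -> descR S x \subset J.
Proof.
move=> sJS Jx; apply/subsetP => s Ds; have := Ds; rewrite descR_root => /andP[Ss nxs].
apply: contraNT nxs => nJs; apply: (coord_gt0_pos (s := s)) => //.
  by rewrite act_root ?alpha_root.
by rewrite (coord_parabolic _ sJS) // coord_alpha // eqxx ltr01.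
Qed.

Lemma ex_descR_parabolic J w : J \subset S -> w \in <<J>>%g -> w != 1%g ->
  exists2 s, s \in J & ~~ pos (w ** alpha s).
Proof.
move=> sJS Jw /ex_descR[s Ds]; exists s; first exact: subsetP (descR_parabolic sJS Jw) s Ds.
by move: Ds; rewrite descR_root => /andP[].
Qed.

Lemma pos_act J a b : J \subset S -> {in J, forall s, pos (a ** alpha s)} ->
  b \in Phi -> spanned J b -> pos (a ** b) = pos b.
Proof.
move=> sJS aJ Pb Jb.
have pos_ac c : c \in Phi -> spanned J c -> pos c -> pos (a ** c).
  move=> Pc Jc /posP pc; apply/posP => t St.
  rewrite (spanned_sum sJS Pc Jc) act_sum coord_sum sumr_ge0 // => s Js.
  by rewrite mulr_ge0 ?pc ?(subsetP sJS) //; apply: (posP _ (aJ s Js)).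
apply/idP/idP; last exact: pos_ac.
apply: contraTT; rewrite -!posN ?act_root // -actN; apply: pos_ac; first exact: rootN.
by rewrite spannedN.
Qed.

Lemma neg_act J a b : J \subset S -> {in J, forall s, ~~ pos (a ** alpha s)} ->
  b \in Phi -> spanned J b -> pos (a ** b) = ~~ pos b.
Proof.
move=> sJS aJ Pb Jb.
have neg_ac c : c \in Phi -> spanned J c -> pos c -> ~~ pos (a ** c).
  move=> Pc Jc /posP pc; rewrite -posN ?act_root //; apply/posP => t St.
  rewrite coordN oppr_ge0 (spanned_sum sJS Pc Jc) act_sum coord_sum sumr_le0 // => s Js.
  rewrite mulr_ge0_le0 ?pc ?(subsetP sJS) // coord_neg ?aJ //.
  by rewrite act_root ?alpha_root ?(subsetP sJS).
apply/idP/idP; first by apply: contraTN; apply: neg_ac.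
rewrite -posN // => nb; rewrite -[a ** b]opprK -actN posN ?act_root ?rootN //.
by apply: neg_ac; rewrite ?rootN ?spannedN.
Qed.

Lemma min_reps_root J a : J \subset S ->
  reflect {in J, forall s, pos (a ** alpha s)} (a \in min_reps S J).
Proof.
move=> sJS; rewrite inE setI_eq0; apply: (iffP pred0P) => [aJ s Js|aJ s].
  have /negbT := aJ s; rewrite /= Js andbT descR_root (subsetP sJS) //=.
  by rewrite negbK.
by apply/negbTE/negP => /andP[/=]; rewrite descR_root => /andP[_ /negP nas] /aJ.
Qed.

(** Otherwise [u^-1 v] makes some [alpha s], [s] in [J], negative. Since [w u] preserves signs on
    the roots spanned by [J], [w v] would make it negative too. *)
Lemma min_reps_uniq J w u v : J \subset S -> u \in <<J>>%g -> v \in <<J>>%g ->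
  {in J, forall s, pos (w ** u ** alpha s)} ->
  {in J, forall s, pos (w ** v ** alpha s)} -> u = v.
Proof.
move=> sJS Ju Jv wu wv; apply/eqP; rewrite eq_mulVg1; apply: contraT.
case/(ex_descR_parabolic sJS) => [|s Js]; first by rewrite groupM ?groupV.
have Ps : alpha s \in Phi by rewrite alpha_root ?(subsetP sJS).
apply: contraNT => _; rewrite -(pos_act (a := (w * u)%g) sJS) ?act_root //.
- by rewrite actM actM actKV wv.
- by move=> t Jt; rewrite actM wu.
by rewrite (spanned_parabolic _ sJS) ?spanned_alpha // groupM ?groupV.
Qed.

Lemma parabolic_partP J w : J \subset S ->
  parabolic_part S J w \in <<J>>%g /\
  {in J, forall s, pos (w ** (parabolic_part S J w)^-1%g ** alpha s)}.
Proof.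
move=> sJS; rewrite /parabolic_part; case: pickP => [u /andP[Ju]|no_u] /=.
  move=> /(min_reps_root _ sJS) wu; split=> // s Js; rewrite -actM; exact: wu.
(* The default value 1 of [parabolic_part] is never reached: an element [u] of W_J making [w * u^-1]
   shortest leaves no descent in [J]. *)
have [u Ju min_u] := @arg_minnP _ 1%g (fun u => u \in <<J>>%g)
  (fun u => length S (w * u^-1)%g) (group1 _).
have /negP[] := negbT (no_u u); rewrite Ju /= inE setI_eq0.
apply/pred0P => s; apply/negbTE/negP => /andP[/=]; rewrite inE => /andP[Ss lt_s] Js.
have := min_u (s * u)%g; rewrite groupM ?(mem_gen Js) // => /(_ isT).
by rewrite invMg mulgA (simple_inv Ss) leqNgt lt_s.
Qed.

Lemma parabolic_part_uniq J w u : J \subset S -> u \in <<J>>%g ->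
  {in J, forall s, pos (w ** u^-1%g ** alpha s)} -> parabolic_part S J w = u.
Proof.
move=> sJS Ju wu; have [Jp wp] := parabolic_partP w sJS.
by apply: invg_inj; apply: (min_reps_uniq sJS _ _ wp wu); rewrite groupV.
Qed.

(* The projection of u on the coset v W_J. *)
Definition gate u v J := (v * (parabolic_part S J (u^-1 * v))^-1)%g.

Lemma gate_coset u v J : J \subset S -> (v^-1 * gate u v J)%g \in <<J>>%g.
Proof. by move=> sJS; rewrite mulKg groupV; case: (parabolic_partP (u^-1 * v)%g sJS). Qed.

Lemma gate_pos u v J s : J \subset S -> s \in J -> pos (u^-1%g ** gate u v J ** alpha s).
Proof.
move=> sJS Js; have [_ /(_ s Js)] := parabolic_partP (u^-1 * v)%g sJS.
by rewrite !actM.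
Qed.

Lemma gate_uniq u v J y : J \subset S -> (v^-1 * y)%g \in <<J>>%g ->
  {in J, forall s, pos (u^-1%g ** y ** alpha s)} -> gate u v J = y.
Proof.
move=> sJS Jy uy; rewrite /gate (parabolic_part_uniq (u := (y^-1 * v)%g)) //.
- by rewrite invMg invgK mulKVg.
- by rewrite -groupV invMg invgK.
by move=> s Js; rewrite invMg invgK !actM actKV uy.
Qed.

(** With [y] the gate, this concerns the root [y ** b] of the coset: [y^-1] sends it to [b], so [u]
    and [y] give it the same sign. *)
Lemma gate_sign u v J b : J \subset S -> b \in Phi -> spanned J b ->
  pos (u^-1%g ** gate u v J ** b) = pos b.
Proof.
move=> sJS Pb Jb; rewrite -actM (pos_act sJS) // => s Js.
by rewrite actM gate_pos.
Qed.

(* Inclusion of inversion sets, by contraposition. *)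
Definition weak_le u v : Prop :=
  {in Phi, forall b, pos b -> pos (v^-1%g ** b) -> pos (u^-1%g ** b)}.

Definition ninv w := count (fun b => pos b && ~~ pos (w^-1%g ** b)) Phi.

Lemma ninv_lt u v b : weak_le u v -> b \in Phi -> pos b -> pos (u^-1%g ** b) ->
  ~~ pos (v^-1%g ** b) -> (ninv u < ninv v)%N.
Proof.
move=> le_uv Pb pb pub nvb; apply: count_lt Pb _ _; rewrite ?pb ?pub ?nvb //.
by move=> c Pc /andP[pc /=]; rewrite pc; apply: contra => /(le_uv c Pc pc).
Qed.

Lemma weak_le_trans v u w : weak_le u v -> weak_le v w -> weak_le u w.
Proof. by move=> le_uv le_vw b Pb pb /(le_vw b Pb pb)/(le_uv b Pb pb). Qed.

(** Any descent [s] of [w^-1 y] works: were [y ** alpha s] positive, it would be a root not inverted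
    by [y] but inverted by [w]. *)
Lemma weak_lt_descR w y : weak_le w y -> w != y ->
  exists2 s, s \in descR S y & ~~ pos (w^-1%g ** y ** alpha s).
Proof.
rewrite eq_mulVg1 => le_wy /ex_descR[s]; rewrite descR_root actM => /andP[Ss nws].
exists s => //; rewrite descR_root Ss; apply: contra nws => pys.
by apply: le_wy; rewrite ?actK ?pos_alpha ?act_root ?alpha_root.
Qed.

Lemma weak_le_anti u v : weak_le u v -> weak_le v u -> u = v.
Proof.
move=> le_uv le_vu; apply/eqP; apply: contraT => /(weak_lt_descR le_uv)[s].
rewrite descR_root => /andP[Ss nvs] nus.
have Pvs : v ** alpha s \in Phi by rewrite act_root ?alpha_root.
have := le_vu _ (rootN Pvs); rewrite !actN actK !posN ?act_root ?alpha_root //.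
by rewrite pos_alpha // => /(_ nvs nus).
Qed.

Lemma act_coset u v b : u^-1%g ** b = (v^-1 * u)^-1%g ** v^-1%g ** b.
Proof. by rewrite -actM (invMg v^-1%g) invgK mulgK. Qed.

(** As [J] consists of descents, [v] inverts all positive roots of the coset [v W_J]. On the
    remaining roots [y] and [v] have the same inversions, so [v] is the maximum of its coset. *)
Lemma weak_le_coset v y J : J \subset descR S v -> (v^-1 * y)%g \in <<J>>%g ->
  weak_le y v.
Proof.
move=> sJD Jx; have sJS := subset_trans sJD (descR_subS v) => b Pb pb.
rewrite (act_coset y v); set c := v^-1%g ** b.
have Pc : c \in Phi by rewrite act_root.
have [Jc|nJc] := boolP (spanned J c); last by rewrite (pos_parabolic sJS) ?groupV.
have nvJ : {in J, forall s, ~~ pos (v ** alpha s)}.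
  by move=> s Js; have := subsetP sJD s Js; rewrite descR_root => /andP[].
by have := neg_act sJS nvJ Pc Jc; rewrite actKV pb; case: (pos c).
Qed.

(** The gate has the signs of [u] on the roots of the coset and those of [v] elsewhere. *)
Lemma weak_le_gate u v J : J \subset descR S v -> weak_le u v ->
  weak_le u (gate u v J) /\ weak_le (gate u v J) v.
Proof.
move=> sJD le_uv; have sJS := subset_trans sJD (descR_subS v).
set y := gate u v J; have Jx : (v^-1 * y)%g \in <<J>>%g := gate_coset u v sJS.
split; last exact: weak_le_coset Jx.
move=> b Pb pb; rewrite (act_coset y v); set c := v^-1%g ** b.
have Pc : c \in Phi by rewrite act_root.
have [Jc|nJc] := boolP (spanned J c); last first.
  by rewrite (pos_parabolic sJS) ?groupV //; apply: le_uv.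
have /(gate_sign u v sJS) : y^-1%g ** b \in Phi by rewrite act_root.
rewrite actKV -act_coset => -> //.
by rewrite (act_coset y v) (spanned_parabolic _ sJS) ?groupV.
Qed.

(** * Lower intervals of the shard order *)

(** With [y] the gate, [y^-1 u] sends [alpha t] to a positive root spanned by [J]. Hence [alpha t]
    is a nonnegative combination of the positive roots [u^-1 y a_m], [m] in [J]. Being simple, it
    equals each of them that has a positive coefficient. *)
Lemma gate_wall u v J t : J \subset S -> t \in S ->
  spanned J (v^-1%g ** u ** alpha t) ->
  exists2 m, m \in J & u ** alpha t = gate u v J ** alpha m.
Proof.
move=> sJS St; have Jx := gate_coset u v sJS; have y_pos := @gate_pos u v J ^~ sJS.
have y_sign := @gate_sign u v J _ sJS; move: (gate u v J) => y in Jx y_pos y_sign *.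
set c := y^-1%g ** u ** alpha t.
have -> : v^-1%g ** u ** alpha t = (v^-1 * y)%g ** c by rewrite /c actM actKV.
rewrite (spanned_parabolic _ sJS) // => Jc.
have Pc : c \in Phi by rewrite !act_root ?alpha_root.
have pc : pos c by rewrite -y_sign // /c actKV actK pos_alpha.
have t_sum : alpha t = \sum_(m in J) cf m c *: (u^-1%g ** y ** alpha m).
  rewrite -[LHS](actK u) -[u ** alpha t](actKV y) -/c {1}(spanned_sum sJS Pc Jc).
  by rewrite !act_sum.
have [m Jm m_gt0] : exists2 m, m \in J & 0 < cf m c.
  apply/exists_inP; apply: contraTT (Pc) => /exists_inPn c0.
  rewrite {1}(spanned_sum sJS Pc Jc) big1 ?(root_neq0 rootPhi) // => m Jm.
  have cm_ge0 := posP _ pc m (subsetP sJS m Jm).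
  have /eqP-> : cf m c == 0 by rewrite eq_le cm_ge0 leNgt c0.
  by rewrite scale0r.
exists m => //.
have Sm := subsetP sJS m Jm.
suff <- : u^-1%g ** y ** alpha m = alpha t by rewrite actKV.
apply: pos_eq_alpha => //; [by rewrite !act_root ?alpha_root | exact: y_pos |].
move=> r Sr ne_rt; have := congr1 (cf r) t_sum.
rewrite coord_alpha // (negbTE ne_rt) coord_sum => /esym sum0.
have terms_ge0 k : k \in J -> 0 <= cf k c * cf r (u^-1%g ** y ** alpha k).
  by move=> Jk; rewrite mulr_ge0 ?(posP _ pc) ?(posP _ (y_pos k Jk)) ?(subsetP sJS k).
by have /eqP := psumr_eq0P terms_ge0 sum0 Jm; rewrite mulf_eq0 gt_eqF //= => /eqP.
Qed.

(** Such a [k] is always a descent of [y], the common root being negative; so the walls of [w] are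
    among those of [y]. *)
Definition walls_sub w y : Prop :=
  {in descR S w, forall t, exists2 k, k \in S & w ** alpha t = y ** alpha k}.

Lemma descR_S w s : s \in descR S w -> s \in S.
Proof. exact: (subsetP (descR_subS w)). Qed.

Lemma descR_neg w s : s \in descR S w -> ~~ pos (w ** alpha s).
Proof. by rewrite descR_root => /andP[]. Qed.

Lemma walls_sub_descR w y t k : t \in descR S w -> k \in S ->
  w ** alpha t = y ** alpha k -> k \in descR S y.
Proof. by move=> Dt Sk eq_tk; rewrite descR_root Sk -eq_tk descR_neg. Qed.

Lemma walls_sub_gate w y : walls_sub w y -> walls_sub w (gate w y (descR S y)).
Proof.
move=> wy t Dt; have [k Sk eq_tk] := wy t Dt.
have [||m Dm ->] := @gate_wall w y (descR S y) t (descR_subS y).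
- exact: descR_S Dt.
- rewrite eq_tk actK spanned_alpha ?descR_subS //.
  exact: walls_sub_descR eq_tk.
by exists m; first exact: descR_S Dm.
Qed.

(** The root [- y a_s] is inverted by [y] but not by [w], hence not by the gate, which agrees with
    [w] on the roots of the coset. *)
Lemma ninv_gate w y s : weak_le w y -> s \in descR S y ->
  ~~ pos (w^-1%g ** y ** alpha s) -> (ninv (gate w y (descR S y)) < ninv y)%N.
Proof.
move=> le_wy Ds nws; have [_ le_y1y] := weak_le_gate (subxx _) le_wy.
have Ps : alpha s \in Phi by rewrite alpha_root ?(descR_S Ds).
apply: (ninv_lt (b := - (y ** alpha s))) => //; rewrite ?rootN ?act_root //.
- by rewrite posN ?act_root // descR_neg.
- rewrite actN posN ?act_root // -(gate_sign w y (descR_subS y)) ?actKV ?act_root //.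
  have -> : (gate w y (descR S y))^-1%g ** y ** alpha s =
     (y^-1 * gate w y (descR S y))^-1%g ** alpha s by rewrite -actM (invMg y^-1%g) invgK.
  rewrite (spanned_parabolic _ (descR_subS y)) ?spanned_alpha ?descR_subS //.
  by rewrite groupV gate_coset ?descR_subS.
by rewrite actN actK posN // negbK pos_alpha ?(descR_S Ds).
Qed.

(* Induction on y through the projection y1 of w to the coset y W_{D(y)}: if the
   wall were lost, no wall of y1 other than those of w could be a descent of
   y1, so y1 would lie opposite to y and the coordinate of alpha s could not be
   positive. *)
Lemma walls_of_weak_le w y s : weak_le w y -> walls_sub w y -> s \in descR S y ->
  pos (w^-1%g ** y ** alpha s) ->
  exists2 t, t \in descR S w & w ** alpha t = y ** alpha s.
Proof.
have [m] := ubnP (ninv y); elim: m y s => // m IHm y s; rewrite ltnS => le_m.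
move=> le_wy wy Ds pws.
suff /exists_inP[t Dt /eqP] : [exists t in descR S w, w ** alpha t == y ** alpha s].
  by exists t.
apply: contraT => /exists_inPn no_t.
have ne_wy : w != y.
  by apply/eqP => eq_wy; have := no_t s; rewrite eq_wy eqxx => /(_ Ds).
have [s0 Ds0 nws0] := weak_lt_descR le_wy ne_wy.
have [le_wy1 le_y1y] := weak_le_gate (subxx _) le_wy.
have lt_y1 := ninv_gate le_wy Ds0 nws0; have wy1 := walls_sub_gate wy.
have sMS := descR_subS y; set M := descR S y in no_t Ds le_wy1 le_y1y lt_y1 wy1 sMS *.
have y1_pos := @gate_pos w y M ^~ sMS; have y1_sign := @gate_sign w y M _ sMS.
have Jx := gate_coset w y sMS.
set y1 := gate w y M in le_wy1 le_y1y lt_y1 wy1 y1_pos y1_sign Jx *.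
have Ss := descR_S Ds.
set b := y1^-1%g ** y ** alpha s.
have Pb : b \in Phi by rewrite !act_root ?alpha_root.
have Mb : spanned M b.
  have -> : b = (y^-1 * y1)^-1%g ** alpha s by rewrite /b -actM (invMg y^-1%g) invgK.
  by rewrite (spanned_parabolic _ sMS) ?groupV // spanned_alpha.
have pb : pos b by rewrite -y1_sign // actKV.
(* [alpha s] is a nonnegative combination of the roots [e = y^-1 y1 a_t], [t] in [M]. Each [e] has
   coordinate at most 0 at [s]: either it is negative, or by induction [y1 a_t] is a wall of [w], so
   that [e] is a simple root other than [alpha s]. *)
suff : (1 : R) <= 0 by rewrite ler10.
have {1}-> : 1 = cf s (y^-1%g ** y1 ** b) by rewrite /b actKV actK coord_alpha // eqxx.
rewrite {1}(spanned_sum sMS Pb Mb) !act_sum coord_sum sumr_le0 // => t Mt.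
have St := descR_S Mt; rewrite mulr_ge0_le0 ?(posP _ pb) //.
set e := y^-1%g ** y1 ** alpha t.
have Pe : e \in Phi by rewrite !act_root ?alpha_root.
have [pt|nt] := boolP (pos (y1 ** alpha t)).
  have nyM : {in M, forall r, ~~ pos (y ** alpha r)} by move=> r /descR_neg.
  apply: coord_neg => //; rewrite -(neg_act sMS nyM Pe); first by rewrite actKV.
  by rewrite /e -actM (spanned_parabolic _ sMS) // spanned_alpha.
have Dt : t \in descR S y1 by rewrite descR_root St nt.
have [t' Dt' eq_t'] := IHm y1 t (leq_trans lt_y1 le_m) le_wy1 wy1 Dt (y1_pos t Mt).
have [k Sk eq_k] := wy t' Dt'.
rewrite /e -eq_t' eq_k actK coord_alpha //; suff /negbTE-> : s != k by [].
by have := no_t t' Dt'; rewrite eq_k; apply: contraNneq => ->.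
Qed.

Definition walls w := [seq w ** alpha t | t in descR S w].

(* Where u and y disagree on the roots of the coset y W_{D(y)}, they disagree on
   all of them but those spanned by the walls of u. *)
Lemma walls_sign u y b : weak_le u y -> walls_sub u y ->
  b \in Phi -> spanned (descR S y) b ->
  pos (u^-1%g ** y ** b) = (pos b == spanned [set s in descR S y | y ** alpha s \in walls u] b).
Proof.
move=> le_uy uy; set K := [set s in _ | _].
suff pos_case c : c \in Phi -> spanned (descR S y) c -> pos c ->
    pos (u^-1%g ** y ** c) = spanned K c.
  move=> Pb Mb; have [pb|nb] := boolP (pos b); first by rewrite pos_case.
  have := pos_case (- b); rewrite rootN // !spannedN posN // nb => /(_ isT Mb isT).
  by rewrite !actN posN ?act_root // => <-; rewrite eq_sym eqbF_neg negbK.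
move=> Pc Mc pc; have sMS := descR_subS y.
have sKS : K \subset S by apply: subset_trans sMS; apply/subsetP => s; rewrite inE => /andP[].
have [Kc|/forall_inPn[s /setDP[Ss nKs] s_neq0]] := boolP (spanned K c).
  rewrite -actM (pos_act sKS) // => s; rewrite inE actM => /andP[_ /imageP[t Dt ->]].
  by rewrite actK pos_alpha ?(descR_S Dt).
have s_gt0 : 0 < cf s c by rewrite lt_def s_neq0 (posP _ pc).
have Ms : s \in descR S y.
  by apply: contraNT s_neq0 => nMs; rewrite (spannedP _ _ Mc).
apply/negP => pos_uyc; set e := u^-1%g ** y ** alpha s.
have Pe : e \in Phi by rewrite !act_root ?alpha_root.
(* For [r] outside D(u), each [u^-1 y a_m] has coordinate at most 0 at [r]: it is negative or a
   simple root of D(u). The positive root [u^-1 y c] combines them with nonnegative coefficients, so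
   every term vanishes, and [e] enters with coefficient [cf s c > 0]. *)
have De : spanned (descR S u) e.
  apply/spannedP => r Sr nDr.
  have term_ge0 m : m \in descR S y ->
      0 <= cf m c * - cf r (u^-1%g ** y ** alpha m).
    move=> Mm; have Sm := descR_S Mm; rewrite mulr_ge0 ?(posP _ pc) // oppr_ge0.
    have [pm|nm] := boolP (pos (u^-1%g ** y ** alpha m)); last first.
      by rewrite coord_neg ?act_root ?alpha_root.
    have [t Dt <-] := walls_of_weak_le le_uy uy Mm pm.
    rewrite actK coord_alpha ?(descR_S Dt) //; suff /negbTE-> : r != t by [].
    by apply: contraNneq nDr => ->.
  have sum_le0 : \sum_(m in descR S y) cf m c * - cf r (u^-1%g ** y ** alpha m) <= 0.
    under eq_bigr do rewrite mulrN.
    by rewrite sumrN oppr_le0 -coord_sum -!act_sum -(spanned_sum sMS) // (posP _ pos_uyc).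
  have /eqP sum0 : \sum_(m in descR S y) cf m c * - cf r (u^-1%g ** y ** alpha m) == 0.
    by rewrite eq_le sum_le0 sumr_ge0.
  have /eqP := psumr_eq0P term_ge0 sum0 Ms.
  by rewrite mulf_eq0 gt_eqF //= oppr_eq0 => /eqP.
(* Now [y a_s = u e] is a combination of walls of [u], which are roots [y a_k] with [k != s] because
   [s] is not in [K]. The coordinate at [s] gives 1 = 0. *)
have := coord_alpha Ss Ss; rewrite -(actK y (alpha s)) -(actKV u (y ** _)) -/e.
rewrite (spanned_sum (descR_subS u) Pe De) !act_sum coord_sum big1 ?eqxx => [/eqP|t Dt].
  by rewrite eq_sym oner_eq0.
have [k Sk eq_tk] := uy t Dt; rewrite eq_tk actK coord_alpha //.
suff /negbTE-> : s != k by rewrite mulr0.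
apply: contraNneq nKs => eq_sk; rewrite inE Ms eq_sk -eq_tk.
by apply/imageP; exists t.
Qed.

(** By [walls_sign], the signs of [u] on the roots of the coset of [y] depend only on its walls. So
    [u] and [v] have the same gate there, which replaces [y] and has fewer inversions unless
    [u = y]. *)
Lemma walls_inj u v y : weak_le u y -> weak_le v y -> walls_sub u y -> walls_sub v y ->
  walls u =i walls v -> u = v.
Proof.
have [m] := ubnP (ninv y); elim: m y => // m IHm y; rewrite ltnS => le_m.
move=> le_uy le_vy uy vy eq_walls.
have top_eq w w' : weak_le w y -> walls w' =i walls w -> w' = y -> w = y.
  move=> le_wy eq_w eq_w'y; apply/eqP; apply: contraT => /(weak_lt_descR le_wy)[s Ds].
  have : y ** alpha s \in walls w.
    by rewrite -eq_w -eq_w'y; apply/imageP; exists s; rewrite ?eq_w'y.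
  by case/imageP => t Dt ->; rewrite actK pos_alpha ?(descR_S Dt).
have [eq_uy|ne_uy] := eqVneq u y; first by rewrite eq_uy (top_eq v u).
have [s Ds nus] := weak_lt_descR le_uy ne_uy; have sMS := descR_subS y.
have eq_gate : gate v y (descR S y) = gate u y (descR S y).
  apply: gate_uniq; rewrite ?gate_coset // => t Mt.
  have := gate_pos u y sMS Mt; set c := gate u y _ ** _.
  suff -> : pos (u^-1%g ** c) = pos (v^-1%g ** c) by [].
  have Pc : y^-1%g ** c \in Phi by rewrite !act_root ?alpha_root ?(descR_S Mt).
  have Mc : spanned (descR S y) (y^-1%g ** c).
    by rewrite -actM (spanned_parabolic _ sMS) ?gate_coset ?spanned_alpha.
  rewrite -(actKV y c) (walls_sign le_uy uy Pc Mc) (walls_sign le_vy vy Pc Mc).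
  suff -> : [set s in descR S y | y ** alpha s \in walls u] =
    [set s in descR S y | y ** alpha s \in walls v] by [].
  by apply/setP => r; rewrite !inE eq_walls.
apply: (IHm (gate u y (descR S y))) => //.
- exact: leq_trans (ninv_gate le_uy Ds nus) le_m.
- by have [] := weak_le_gate (subxx _) le_uy.
- by rewrite -eq_gate; have [] := weak_le_gate (subxx _) le_vy.
- exact: walls_sub_gate.
- by rewrite -eq_gate; apply: walls_sub_gate.
Qed.

(* Take u with the fewest inversions among the elements below y that invert the
   roots - y a_s, s in K. *)
Lemma ex_walls y K : K \subset descR S y ->
  exists2 u, weak_le u y & walls u =i [seq y ** alpha s | s in K].
Proof.
move=> sKD; pose P u := `[< weak_le u y >] && [forall s in K, pos (u^-1%g ** y ** alpha s)].
have Py : P y.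
  apply/andP; split; first exact/asboolP.
  by apply/forall_inP => s /(subsetP sKD)/descR_S Ss; rewrite actK pos_alpha.
have [u /andP[/asboolP le_uy /forall_inP Ku] min_u] := arg_minnP ninv Py.
(* By minimality [u t] violates the condition for some [s] in [K]: the positive root [u^-1 y a_s]
   becomes negative under [t], so it is [alpha t]. *)
have uK t : t \in descR S u -> exists2 s, s \in K & u ** alpha t = y ** alpha s.
  move=> Dt; have St := descR_S Dt.
  have le_ut : weak_le (u * t)%g u.
    move=> b Pb pb pub; rewrite invMg actM (simple_inv St) act_simple_pos ?act_root //.
    apply: contraTneq pb => /(congr1 (fun c => u ** c)); rewrite actKV => ->.
    exact: descR_neg.
  have lt_ut : (ninv (u * t)%g < ninv u)%N.
    apply: (ninv_lt (b := - (u ** alpha t))) => //; rewrite ?rootN ?act_root ?alpha_root //.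
    - by rewrite posN ?descR_neg ?act_root ?alpha_root.
    - by rewrite actN invMg actM (simple_inv St) actK act_alpha // opprK pos_alpha.
    by rewrite actN actK posN ?negbK ?pos_alpha ?alpha_root.
  have : ~~ P (u * t)%g by apply: contraL lt_ut => /min_u; rewrite -leqNgt.
  rewrite /P; have -> /= : `[< weak_le (u * t)%g y >].
    by apply/asboolP; apply: weak_le_trans le_uy.
  case/forall_inPn => s Ks; rewrite invMg actM (simple_inv St) => nts; exists s => //.
  suff <- : u^-1%g ** y ** alpha s = alpha t by rewrite actKV.
  have Ps : alpha s \in Phi by rewrite alpha_root ?(descR_S (subsetP sKD s Ks)).
  by apply: contraNeq nts; apply: act_simple_pos; rewrite ?act_root ?Ku.
exists u => // c; apply/imageP/imageP => [[t /uK[s Ks ->] ->]|[s Ks ->]]; first by exists s.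
have uy : walls_sub u y.
  by move=> t /uK[r Kr ->]; exists r; rewrite ?(descR_S (subsetP sKD r Kr)).
have [t Dt eq_ts] := walls_of_weak_le le_uy uy (subsetP sKD s Ks) (Ku s Ks).
by exists t.
Qed.

(** The shard order in terms of roots: by [descent_group_subset], the second clause is the inclusion
    of G(u) in G(v). *)
Definition shard_rel u v : Prop := weak_le u v /\
  {in descR S u, forall t, spanned (descR S v) (v^-1%g ** u ** alpha t)}.

Definition shard_gate v u := gate u v (descR S v).

(** [gate_wall] makes every wall of [u] a wall of the gate [y] indexed in D(v). Conversely, for [s]
    in D(v) the root [u^-1 y a_s] is positive, so [walls_of_weak_le] recovers the wall [y a_s]. *)
Lemma walls_shard_gate u v : shard_rel u v ->
  walls u =i [seq shard_gate v u ** alpha s | s in descR S (shard_gate v u) :&: descR S v].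
Proof.
case=> le_uv uv; have sJS := descR_subS v; have [le_uy _] := weak_le_gate (subxx _) le_uv.
rewrite /shard_gate; set y := gate _ _ _ in le_uy *.
have uJ t : t \in descR S u -> exists2 s, s \in descR S y :&: descR S v &
    u ** alpha t = y ** alpha s.
  move=> Dt; have [m Jm eq_tm] := gate_wall sJS (descR_S Dt) (uv t Dt).
  exists m => //; rewrite inE Jm (walls_sub_descR Dt _ eq_tm) //.
  exact: descR_S Jm.
move=> c; apply/imageP/imageP => [[t /uJ[s Js ->] ->]|[s /setIP[Ds Js] ->]]; first by exists s.
have uy : walls_sub u y.
  by move=> t /uJ[r /setIP[/descR_S Sr _] ->]; exists r.
have [t Dt eq_ts] := walls_of_weak_le le_uy uy Ds (gate_pos u v sJS Js).
by exists t.
Qed.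

Lemma shard_gate_coset u v : (v^-1 * shard_gate v u)%g \in <<descR S v>>%g.
Proof. exact/gate_coset/descR_subS. Qed.

Lemma shard_gate_inj u u' v : shard_rel u v -> shard_rel u' v ->
  shard_gate v u = shard_gate v u' -> u = u'.
Proof.
move=> uv u'v eq_y; have [[le_uv _] [le_u'v _]] := (uv, u'v).
have sub_y w : shard_rel w v -> walls_sub w (shard_gate v w).
  move=> wv t Dt; have : w ** alpha t \in walls w by apply/imageP; exists t.
  by rewrite (walls_shard_gate wv) => /imageP[k /setIP[/descR_S Sk _] ->]; exists k.
apply: (@walls_inj _ _ (shard_gate v u)).
- by have [] := weak_le_gate (subxx _) le_uv.
- by rewrite eq_y; have [] := weak_le_gate (subxx _) le_u'v.
- exact: sub_y.
- by rewrite eq_y; apply: sub_y.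
by move=> c; rewrite (walls_shard_gate uv) (walls_shard_gate u'v) eq_y.
Qed.

(** Take [u] below [y] whose walls are those of [y] indexed in D(v). For [s] in D(v), [u^-1 y a_s]
    is a simple root if [s] is a descent of [y]; otherwise [y a_s] is positive and not inverted by
    [y], hence not by [u]. So [y] is the gate of [u]. *)
Lemma shard_gate_surj v y : (v^-1 * y)%g \in <<descR S v>>%g ->
  exists2 u, shard_rel u v & shard_gate v u = y.
Proof.
move=> Jy; have sJS := descR_subS v.
have [u le_uy walls_u] := ex_walls (subsetIl (descR S y) (descR S v)).
have uy t : t \in descR S u -> exists2 s, s \in descR S v & u ** alpha t = y ** alpha s.
  move=> Dt; have : u ** alpha t \in walls u by apply/imageP; exists t.
  by rewrite walls_u => /imageP[s /setIP[_ Js] ->]; exists s.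
exists u; first split.
- exact: weak_le_trans le_uy (weak_le_coset (subxx _) Jy).
- move=> t /uy[s Js ->]; rewrite -actM (spanned_parabolic _ sJS) //.
  exact: spanned_alpha.
apply: gate_uniq => // s Js; have Ss := descR_S Js.
have [Ds|] := boolP (s \in descR S y).
  have : y ** alpha s \in walls u by rewrite walls_u; apply/imageP; exists s; rewrite // inE Ds.
  by case/imageP => t Dt ->; rewrite actK pos_alpha ?(descR_S Dt).
rewrite descR_root Ss negbK => pys.
by apply: le_uy; rewrite ?actK ?pos_alpha ?act_root ?alpha_root.
Qed.

Lemma descR_shard_gate u v : shard_rel u v ->
  descR S (shard_gate v u) :&: descR S v = (descR S u :^ (u^-1 * shard_gate v u))%g.
Proof.
move=> uv; have walls_u := walls_shard_gate uv.
have conj t s : t \in S -> s \in S -> u ** alpha t = shard_gate v u ** alpha s ->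
    (t ^ (u^-1 * shard_gate v u))%g = s.
  move=> St Ss eq_ts; set y := shard_gate v u.
  have := @conj_simple t s (y^-1 * u)%g St Ss.
  rewrite conjgE (invMg u^-1%g) (invMg y^-1%g) !invgK !mulgA => -> //.
  by rewrite actM eq_ts actK.
apply/setP => s; apply/idP/imsetP => [Js|[t Dt ->]].
  have : shard_gate v u ** alpha s \in walls u by rewrite walls_u; apply/imageP; exists s.
  case/imageP => t Dt eq_st; exists t => //; apply/esym/conj; rewrite ?(descR_S Dt) //.
  by case/setIP: Js => /descR_S.
have : u ** alpha t \in walls u by apply/imageP; exists t.
rewrite walls_u => /imageP[r Jr eq_tr]; rewrite (conj t r) ?(descR_S Dt) //.
by case/setIP: Jr => /descR_S.
Qed.

(** * Descent groups as conjugates of parabolic subgroups *)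

Lemma mem_parabolic J w : J \subset S ->
  {in S, forall r, r \notin J -> forall b, cf r (w ** b) = cf r b} -> w \in <<J>>%g.
Proof.
move=> sJS; have [m] := ubnP (length S w); elim: m w => // m IHm w; rewrite ltnS => le_m w_fix.
have [->|/ex_descR[s Ds]] := eqVneq w 1%g; first exact: group1.
(* A descent [s] outside [J] is impossible: [w ** alpha s] would have coordinate 1 at [s] and be
   positive. *)
have Ss := descR_S Ds; have Js : s \in J.
  apply: contraNT (descR_neg Ds) => nJs; apply: (coord_gt0_pos (s := s)) => //.
    by rewrite act_root ?alpha_root.
  by rewrite w_fix // coord_alpha // eqxx ltr01.
rewrite -(groupMr _ (mem_gen Js)); apply: IHm => [|r Sr nJr b].
  by move: Ds; rewrite inE => /andP[_ /leq_trans]; apply.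
by rewrite actM w_fix // coord_act_simple //; apply: contraNneq nJr => ->.
Qed.

(** The conjugate is the reflection in [g ** alpha t]. It negates that root, and it fixes all
    coordinates outside [J] exactly when they vanish on the root. *)
Lemma mem_parabolic_reflection J g t : J \subset S -> t \in S ->
  ((g * t * g^-1)%g \in <<J>>%g) = spanned J (g ** alpha t).
Proof.
move=> sJS St; apply/idP/idP => [Jx|Jb].
  apply/spannedP => r Sr nJr; have := coord_parabolic (g ** alpha t) sJS Jx nJr.
  rewrite !actM actK act_alpha // actN coordN => /eqP.
  by rewrite eq_sym -addr_eq0 -mulr2n mulrn_eq0 => /eqP.
apply: (mem_parabolic sJS) => r Sr nJr b.
rewrite !actM (act_simpleE _ St) mulmxBr actKV -scalemxAr coordBZ.
by rewrite (spannedP _ _ Jb) // mulr0 subr0.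
Qed.

Lemma descent_group_subset u v :
  reflect {in descR S u, forall t, spanned (descR S v) (v^-1%g ** u ** alpha t)}
    (descent_group S u \subset descent_group S v).
Proof.
have conjE w : [set (w * s * w^-1)%g | s in descR S w] = (descR S w :^ w^-1)%g.
  by apply: eq_imset => s; rewrite conjgE invgK mulgA.
have refl_mem t : t \in descR S u -> ((u * t * u^-1)%g \in <<[set (v * s * v^-1)%g | s in descR S v]>>%g) =
    spanned (descR S v) (v^-1%g ** u ** alpha t).
  move=> /descR_S St; rewrite conjE genJ mem_conjgV conjgE.
  rewrite -actM -(mem_parabolic_reflection _ (descR_subS v) St).
  by rewrite (invMg v^-1%g) invgK !mulgA.
rewrite /descent_group gen_subG.
apply: (iffP subsetP) => [sub t Dt|sub _ /imsetP[t Dt ->]]; last by rewrite refl_mem ?sub.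
by rewrite -refl_mem //; apply/sub/imsetP; exists t.
Qed.

Lemma mem_inversions w b :
  (b \in inversions S rG Phi alpha w) = [&& b \in Phi, pos b & ~~ pos (w^-1%g ** b)].
Proof.
have mem_pos c : (c \in positive_roots S Phi alpha) = (c \in Phi) && pos c.
  by rewrite mem_filter andbC; case Pc: (c \in Phi) => //=; rewrite nonneg_combE.
rewrite mem_filter mem_pos andbC -andbA; apply: andb_id2l => Pb; congr (_ && _).
apply/mapP/idP => [[g]|nb].
  by rewrite mem_pos => /andP[Pg pg] ->; rewrite actK posN // negbK.
exists (- (w^-1%g ** b)); last by rewrite opprK actKV.
by rewrite mem_pos rootN ?posN ?act_root.
Qed.

Lemma shard_leP u v : reflect (shard_rel u v) (shard_le S rG Phi alpha u v).
Proof.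
apply: (iffP andP) => [[/allP le_uv /descent_group_subset uv]|[le_uv uv]]; split=> //.
- move=> b Pb pb; apply: contraTT => nub.
  by have := le_uv b; rewrite /= !mem_inversions Pb pb nub => /(_ isT).
- apply/allP => b; rewrite /= !mem_inversions => /and3P[Pb pb nub].
  by rewrite Pb pb; apply: contra nub; apply: le_uv.
exact/descent_group_subset.
Qed.

Lemma shard_le_refl : reflexive (shard_le S rG Phi alpha).
Proof. by move=> u; apply/andP; split; [apply/allP|]. Qed.

Lemma shard_le_anti : antisymmetric (shard_le S rG Phi alpha).
Proof. by move=> u v /andP[/shard_leP[le_uv _] /shard_leP[le_vu _]]; apply: weak_le_anti. Qed.

Lemma shard_le_trans : transitive (shard_le S rG Phi alpha).
Proof.
move=> v u w /andP[/allP uv guv] /andP[/allP vw gvw]; apply/andP; split.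
  by apply/allP => b /uv/vw.
exact: subset_trans gvw.
Qed.

(** * Supports and the BHZ order *)

(** The last letter of a reduced word is a descent, hence lies in [I], and removing it leaves a
    reduced word of an element of W_I. *)
Lemma reduced_word_parabolic I w (t : seq gT) : I \subset S -> w \in <<I>>%g ->
  reduced_word S w t -> all (mem I) t.
Proof.
move=> sIS; elim/last_ind: t w => // t s IHt w Iw.
case/and3P; rewrite !all_rcons size_rcons big_rcons => /andP[/= Ss St] /eqP sz_t /eqP w_t.
have ws_t : (\prod_(x <- t) x = w * s)%g by rewrite -w_t /= -mulgA simple_sqr // mulg1.
have len_ws : (length S (w * s)%g <= size t)%N by rewrite -ws_t length_word.
have Is : s \in I.
  by apply: (subsetP (descR_parabolic sIS Iw)); rewrite inE Ss -sz_t ltnS.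
rewrite Is (IHt (w * s)%g) //; first by rewrite groupM ?(mem_gen Is).
rewrite /reduced_word St ws_t eqxx andbT eqn_leq len_ws andbT.
have [t' /and3P[St' /eqP <- /eqP w_t']] := ex_reduced_word generatedS (w * s)%g.
rewrite -ltnS sz_t -(size_rcons t' s); have -> : w = (\prod_(x <- rcons t' s) x)%g.
  by rewrite big_rcons /= w_t' -mulgA simple_sqr // mulg1.
by rewrite length_word // all_rcons /= Ss.
Qed.

Lemma supportP w s : reflect (exists2 t : seq gT, reduced_word S w t & s \in t)
  (s \in support S w).
Proof.
rewrite inE; apply: (iffP existsP) => [[t /andP[w_t t_s]]|[t w_t t_s]]; first by exists t.
have /and3P[_ sz_t _] := w_t; exists (Tuple sz_t); exact/andP.
Qed.

Lemma support_subset I w : I \subset S -> (support S w \subset I) = (w \in <<I>>%g).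
Proof.
move=> sIS; apply/idP/idP => [/subsetP sI|Iw].
  have [t w_t] := ex_reduced_word generatedS w; have /and3P[_ _ /eqP <-] := w_t.
  rewrite big_seq group_prod // => s t_s; apply/mem_gen/sI/supportP.
  by exists t.
apply/subsetP => s /supportP[t w_t]; apply/allP.
exact: reduced_word_parabolic w_t.
Qed.

Lemma support_subS w : support S w \subset S.
Proof. by rewrite support_subset // generatedS inE. Qed.

Lemma mem_support w : w \in <<support S w>>%g.
Proof. by rewrite -support_subset ?support_subS. Qed.

Lemma parabolic_trivial J a : J \subset S -> a \in <<J>>%g ->
  {in J, forall s, pos (a ** alpha s)} -> a = 1%g.
Proof.
move=> sJS Ja pa; apply/eqP; apply: contraT => /(ex_descR_parabolic sJS Ja)[s Js].
by rewrite pa.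
Qed.

Lemma bhz_leP u v :
  reflect {in support S u, forall s, pos ((v * u^-1)%g ** alpha s)} (bhz_le S u v).
Proof.
have sJS := support_subS u.
apply: (iffP eqP) => [u_v s Js|pos_vu].
  have [_ pos_v] := parabolic_partP v sJS.
  by rewrite actM -{1}u_v; apply: pos_v.
by apply: parabolic_part_uniq => // [|s Js]; rewrite ?mem_support // -actM pos_vu.
Qed.

(** The point is that [u] lies in W_K, [K = S(v)]. The component [p] of [v] in the parabolic
    subgroup of [J :&: K] leaves [v p^-1] in W_K, without descents outside [K]; so [p] is also the
    component for [J], which is [u]. *)
Lemma bhz_support u v : bhz_le S u v ->
  support S v = support S (v * u^-1)%g :|: support S u.
Proof.
move=> /bhz_leP pos_vu; have [sJS sKS] := (support_subS u, support_subS v).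
set J := support S u in pos_vu sJS *; set K := support S v in sKS *.
have sJKS : J :&: K \subset S by rewrite subIset ?sJS.
have [] := parabolic_partP v sJKS; set p := parabolic_part _ _ _ => JKp pos_vp.
have Kp : p \in <<K>>%g := subsetP (genS (subsetIr _ _)) _ JKp.
have Ku : u \in <<K>>%g.
  suff <- : p = u by [].
  have <- : parabolic_part S J v = u by apply/eqP; exact/bhz_leP.
  apply/esym/parabolic_part_uniq => // [|s Js].
    exact: subsetP (genS (subsetIl _ _)) _ JKp.
  have [Ks|nKs] := boolP (s \in K); first by apply: pos_vp; rewrite inE Js.
  have Ka : (v * p^-1)%g \in <<K>>%g by rewrite groupM ?groupV ?mem_support.
  have := contra (subsetP (descR_parabolic sKS Ka) s) nKs.
  by rewrite descR_root (subsetP sJS) // negbK actM.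
apply/eqP; rewrite eqEsubset; apply/andP; split.
  have sUS : support S (v * u^-1)%g :|: J \subset S by rewrite subUset support_subS.
  rewrite support_subset // -{1}[v](mulgKV u) groupM //.
    exact: subsetP (genS (subsetUl _ _)) _ (mem_support _).
  exact: subsetP (genS (subsetUr _ _)) _ (mem_support u).
rewrite subUset; apply/andP; split; rewrite /J support_subset //.
by rewrite groupM ?groupV ?mem_support.
Qed.

Lemma bhz_le_refl : reflexive (bhz_le S).
Proof.
move=> u; apply/bhz_leP => s /(subsetP (support_subS u)) Ss.
by rewrite mulgV act1 pos_alpha.
Qed.

Lemma bhz_support_eq u v : bhz_le S u v -> support S u = support S v -> u = v.
Proof.
move=> /bhz_leP pos_vu eq_uv; apply/esym/eqP; rewrite eq_mulgV1; apply/eqP.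
apply: parabolic_trivial (support_subS u) _ pos_vu.
by rewrite groupM ?groupV ?mem_support // eq_uv mem_support.
Qed.

Lemma bhz_le_anti : antisymmetric (bhz_le S).
Proof.
move=> u v /andP[uv vu]; apply: bhz_support_eq (uv) _.
apply/eqP; rewrite eqEsubset; apply/andP.
by split; [rewrite (bhz_support uv)|rewrite (bhz_support vu)]; apply: subsetUr.
Qed.

Lemma bhz_le_trans : transitive (bhz_le S).
Proof.
move=> v u w uv vw; apply/bhz_leP => s Js.
have Ss := subsetP (support_subS u) s Js; have Ps := alpha_root Ss.
have -> : (w * u^-1 = (w * v^-1) * (v * u^-1))%g by rewrite mulgA mulgKV.
have sKS := support_subS v; have sJK : support S u \subset support S v.
  by rewrite (bhz_support uv) subsetUr.
rewrite actM (pos_act sKS); first exact: (bhz_leP _ _ uv).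
- exact: (bhz_leP _ _ vw).
- by rewrite act_root.
rewrite (spanned_parabolic _ sKS) ?spanned_alpha ?(subsetP sJK) //.
by rewrite groupM ?groupV ?mem_support // -support_subset.
Qed.

(** * Counting chains *)

Definition descent_count K L := #|[set x in <<L>>%g | descR S x == K]|.

Definition support_count J K := #|[set a in min_reps S J | support S a :|: J == K]|.

(** The kernel is transposed, so that steps descend from [J] to descent sets of elements of W_J. The
    value at D(v) is the number of shard chains with top [v] and [k] elements below it. *)
Definition parabolic_weight k := iter k
  (kernel_step (fun I : {set gT} => I \subset S) (fun J K => descent_count K J)) (fun=> 1%N).

Definition support_weight k := iter k
  (kernel_step (fun I : {set gT} => I \subset S) support_count) (fun=> 1%N).

Lemma sum_fibers (T : finType) (A : {set T}) (h : T -> {set gT}) (P : pred {set gT})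
    (G : {set gT} -> nat) :
  (\sum_(x in A | P (h x)) G (h x) = \sum_(K | P K) #|[set x in A | h x == K]| * G K)%N.
Proof.
rewrite (partition_big h P) => [|x /andP[]//]; apply: eq_bigr => K PK.
rewrite -sum1_card big_distrl /=; apply: eq_big => [x|x /andP[_ /eqP->]]; last by rewrite mul1n.
by rewrite inE -andbA; case: eqP => [->|]; rewrite ?PK ?andbF ?andbT.
Qed.

Lemma sum_parabolic_descents J (G : {set gT} -> nat) : J \subset S ->
  (\sum_(x in <<J>>%g | descR S x != J) G (descR S x) =
   kernel_step (fun I : {set gT} => I \subset S) (fun J K => descent_count K J) G J)%N.
Proof.
move=> sJS; rewrite /kernel_step /descent_count.
rewrite -(@sum_fibers _ _ (descR S) (fun K => (K \subset S) && (K != J))).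
by apply: eq_bigl => x; rewrite descR_subS.
Qed.

(** A reduced word of [w] has its letters in [J], so conjugating it letter by letter gives a word in
    [S]. *)
Lemma length_conj_le J g w : J \subset S -> (J :^ g)%g \subset S -> w \in <<J>>%g ->
  (length S (w ^ g)%g <= length S w)%N.
Proof.
move=> sJS sJgS Jw; have [t w_t] := ex_reduced_word generatedS w.
have /allP Jt := reduced_word_parabolic sJS Jw w_t.
have /and3P[_ /eqP <- /eqP <-] := w_t.
rewrite (big_morph (fun x => x ^ g)%g (fun x y => conjMg x y g) (conj1g g)).
rewrite -(size_map (fun x => x ^ g)%g) -(big_map (fun x => x ^ g)%g xpredT id) length_word //.
apply/allP => _ /mapP[s /Jt Js ->]; apply: (subsetP sJgS).
by rewrite memJ_conjg.
Qed.

Lemma length_conj J g w : J \subset S -> (J :^ g)%g \subset S -> w \in <<J>>%g ->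
  length S (w ^ g)%g = length S w.
Proof.
move=> sJS sJgS Jw; apply/eqP; rewrite eqn_leq (length_conj_le sJS) //=.
rewrite -{1}(conjgK g w); apply: length_conj_le sJgS _ _; first by rewrite conjsgK.
by rewrite genJ memJ_conjg.
Qed.

Lemma descR_conj J g w : J \subset S -> (J :^ g)%g \subset S -> w \in <<J>>%g ->
  descR S (w ^ g)%g = (descR S w :^ g)%g.
Proof.
move=> sJS sJgS Jw; apply/setP => s; rewrite mem_conjg.
have Jwg : (w ^ g)%g \in <<J :^ g>>%g by rewrite genJ memJ_conjg.
have descE r : r \in J -> ((r ^ g)%g \in descR S (w ^ g)%g) = (r \in descR S w).
  move=> Jr; rewrite !inE (subsetP sJS _ Jr) (subsetP sJgS) ?memJ_conjg //=.
  by rewrite -conjMg !(length_conj sJS) // groupM // mem_gen.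
apply/idP/idP => [Ds|Ds].
  have := subsetP (descR_parabolic sJgS Jwg) s Ds.
  by rewrite mem_conjg => /descE <-; rewrite conjgKV.
have /descE := subsetP (descR_parabolic sJS Jw) _ Ds.
by rewrite conjgKV Ds.
Qed.

(** The passage from [u] to its gate preserves descent sets only up to conjugation. Conjugation by
    [g] carries W_J with its simple generators to the parabolic subgroup of the conjugate set, along
    with all descent sets. *)
Lemma parabolic_weight_conj k J g : J \subset S -> (J :^ g)%g \subset S ->
  parabolic_weight k (J :^ g)%g = parabolic_weight k J.
Proof.
elim: k J => // k IHk J sJS sJgS.
rewrite /parabolic_weight !iterS -!sum_parabolic_descents // -/(parabolic_weight k).
rewrite (reindex_inj (conjg_inj g)); apply: eq_big => [x|x].
  rewrite genJ memJ_conjg; apply: andb_id2l => Jx.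
  by rewrite (descR_conj sJS) // (inj_eq (@conjsg_inj _ g)).
case/andP; rewrite genJ memJ_conjg => Jx _; rewrite (descR_conj sJS) // IHk ?descR_subS //.
apply: subset_trans sJgS; rewrite conjSg; exact: descR_parabolic.
Qed.

Lemma chains_below_shard k v :
  iter k (kernel_step predT (fun v u => shard_le S rG Phi alpha u v : nat)) (fun=> 1%N) v =
  parabolic_weight k (descR S v).
Proof.
elim: k v => // k IHk v; set J := descR S v; have sJS : J \subset S := descR_subS v.
rewrite iterS (eq_kernel_step _ _ (fun u _ => IHk u)) /parabolic_weight iterS.
rewrite -sum_parabolic_descents // -/(parabolic_weight k) /kernel_step.
pose A := [set u | (u != v) && shard_le S rG Phi alpha u v].
transitivity (\sum_(u in A) parabolic_weight k (descR S u))%N.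
  rewrite [RHS](eq_bigl (fun u => (u != v) && shard_le S rG Phi alpha u v)) => [|u]; last by rewrite inE.
  by rewrite [RHS]big_mkcondr; apply: eq_bigr => u _; case: ifP; rewrite ?mul1n ?mul0n.
(* Dividing by the minimal representative [a] of [v W_J] identifies the coset with W_J. As [a]
   preserves signs on the roots spanned by [J], D(y) :&: J becomes the descent set of [a^-1 y]. *)
have [Jp pos_a] := parabolic_partP v sJS.
set p := parabolic_part S J v in Jp pos_a; set a := (v * p^-1)%g.
pose h u := (a^-1 * shard_gate v u)%g.
have a_sign b : b \in Phi -> spanned J b -> pos (a ** b) = pos b.
  by move=> Pb Jb; apply: (pos_act sJS) => // s Js; rewrite actM pos_a.
have Jh y : ((a^-1 * y)%g \in <<J>>%g) = ((v^-1 * y)%g \in <<J>>%g).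
  by rewrite (invMg v) invgK -mulgA groupMl.
have descR_h y : (v^-1 * y)%g \in <<J>>%g ->
    descR S (a^-1 * y)%g = descR S y :&: J.
  rewrite -Jh => Jx; apply/setP => s; rewrite in_setI.
  have [Js|nJs] := boolP (s \in J); rewrite ?andbT ?andbF; last first.
    by apply: contraNF nJs; apply: (subsetP (descR_parabolic sJS Jx)).
  have Ss := subsetP sJS s Js; rewrite !descR_root Ss /= -[in RHS](mulKVg a y) [in RHS]actM a_sign //.
    by rewrite act_root ?alpha_root.
  by rewrite (spanned_parabolic _ sJS) ?spanned_alpha.
have gate_v : shard_gate v v = v.
  by apply: gate_uniq => // [|s Js]; rewrite ?mulVg ?group1 // actK pos_alpha ?(subsetP sJS).
have vv : shard_rel v v by apply/shard_leP; apply: shard_le_refl.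
(* This matches the omitted diagonal terms: if D(y) contains [J], then [y] and [v] are both the
   maximum of the coset, so [y = v]. *)
have full_descent u : shard_rel u v -> (descR S (h u) == J) = (u == v).
  move=> uv; rewrite descR_h ?shard_gate_coset //; apply/eqP/eqP => [|->]; last by rewrite gate_v setIid.
  move/setIidPr => sJD; apply: (shard_gate_inj uv vv); rewrite gate_v.
  apply: weak_le_anti; first exact: weak_le_coset (subxx _) (shard_gate_coset u v).
  apply: weak_le_coset sJD _.
  by rewrite -groupV invMg invgK shard_gate_coset.
have h_inj : {in A &, injective h}.
  move=> u u'; rewrite !inE => /andP[_ /shard_leP uv] /andP[_ /shard_leP u'v] /mulgI.
  exact: shard_gate_inj.
transitivity (\sum_(u in A) parabolic_weight k (descR S (h u)))%N.
  apply: eq_bigr => u; rewrite inE => /andP[_ /shard_leP uv].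
  rewrite descR_h ?shard_gate_coset // descR_shard_gate // parabolic_weight_conj ?descR_subS //.
  by rewrite -descR_shard_gate // subIset ?descR_subS.
rewrite -(big_imset (fun x => parabolic_weight k (descR S x)) h_inj) /=.
apply: eq_bigl => x; apply/imsetP/andP => [[u]|[Jx nJx]].
  rewrite inE => /andP[ne_uv /shard_leP uv] ->.
  by rewrite Jh shard_gate_coset full_descent.
have Jy : (v^-1 * (a * x))%g \in <<J>>%g by rewrite -Jh mulKg.
have [u uv gate_u] := shard_gate_surj Jy.
have h_u : h u = x by rewrite /h gate_u mulKg.
exists u => //; rewrite inE -full_descent // h_u nJx; exact/shard_leP.
Qed.

Lemma chains_above_bhz k u :
  iter k (kernel_step predT (fun u v => bhz_le S u v : nat)) (fun=> 1%N) u =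
  support_weight k (support S u).
Proof.
elim: k u => // k IHk u; set J := support S u; have sJS : J \subset S := support_subS u.
rewrite iterS (eq_kernel_step _ _ (fun u _ => IHk u)) /support_weight iterS.
rewrite -/(support_weight k) /kernel_step /support_count.
rewrite -(@sum_fibers _ _ (fun a => support S a :|: J) (fun K => (K \subset S) && (K != J))).
(* The substitution is [a = v u^-1]. The diagonal terms match because S(v) = S(u) forces [v = u]
   above [u]. *)
rewrite [RHS](reindex_inj (mulIg u^-1%g)) /=.
have bhzE v : bhz_le S u v = ((v * u^-1)%g \in min_reps S J).
  exact/bhz_leP/(min_reps_root _ sJS).
rewrite [LHS](eq_bigl (fun v => v != u)) //.
rewrite [LHS](eq_bigr (fun v => if bhz_le S u v then support_weight k (support S v) else 0%N)).
  rewrite -big_mkcondr /=; apply: eq_big => [v|v /andP[_ uv]]; last by rewrite (bhz_support uv).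
  rewrite -bhzE andbC; apply: andb_id2l => uv.
  rewrite -(bhz_support uv) support_subS /=; congr (~~ _).
  apply/eqP/eqP => [->//|eq_J]; apply/esym; exact: bhz_support_eq.
by move=> v _; case: bhz_le; rewrite ?mul1n ?mul0n.
Qed.

Lemma ex_longest J : J \subset S ->
  exists2 g, g \in <<J>>%g & {in J, forall s, ~~ pos (g ** alpha s)}.
Proof.
move=> sJS; have [g Jg max_g] := @arg_maxnP _ 1%g (fun u => u \in <<J>>%g) (length S) (group1 _).
exists g => // s Js; have Ss := subsetP sJS s Js; have := max_g (g * s)%g.
rewrite groupM ?(mem_gen Js) // => /(_ isT); apply: contraTN => pgs.
have Ds : s \in descR S (g * s)%g.
  by rewrite descR_root Ss actM act_alpha // actN posN ?negbK ?act_root ?alpha_root.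
by move: Ds; rewrite inE -mulgA simple_sqr // mulg1 -ltnNge => /andP[].
Qed.

Lemma longest_descR J g : J \subset S -> g \in <<J>>%g ->
  {in J, forall s, ~~ pos (g ** alpha s)} -> descR S g = J.
Proof.
move=> sJS Jg ng; apply/eqP; rewrite eqEsubset descR_parabolic //=.
by apply/subsetP => s Js; rewrite descR_root (subsetP sJS) // ng.
Qed.

(** Two elements of W_J with descent set [J] are each the maximum of W_J in the weak order. *)
Lemma descent_count_diag J : J \subset S -> descent_count J J = 1%N.
Proof.
move=> sJS; have [g Jg ng] := ex_longest sJS.
rewrite /descent_count -(cards1 g); apply: eq_card => x; rewrite !inE.
apply/andP/eqP => [[Jx /eqP Dx]|->]; last by rewrite Jg (longest_descR sJS).
have Dg := longest_descR sJS Jg ng.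
have weak x1 x2 : x1 \in <<J>>%g -> x2 \in <<J>>%g -> descR S x2 = J -> weak_le x1 x2.
  move=> Jx1 Jx2 Dx2; apply: (@weak_le_coset _ _ J); rewrite ?Dx2 //.
  by rewrite groupM ?groupV.
by apply: weak_le_anti; apply: weak.
Qed.

Lemma support_count_diag J : J \subset S -> support_count J J = 1%N.
Proof.
move=> sJS; rewrite /support_count -(cards1 (1%g : gT)).
apply: eq_card => x; rewrite inE in_set1; apply/andP/eqP => [[/(min_reps_root _ sJS) px /eqP]|->].
  by move/setUidPr; rewrite support_subset // => Jx; apply: parabolic_trivial px.
split; last by apply/eqP/setUidPr; rewrite support_subset.
by apply/(min_reps_root _ sJS) => s Js; rewrite act1 pos_alpha ?(subsetP sJS).
Qed.

(* Right multiplication by the longest element of W_J exchanges the minimal and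
   the maximal representatives of the cosets of W_J. *)
Lemma descent_support_count J (L : {set gT}) : J \subset S -> L \subset S ->
  (\sum_(K : {set gT} | (K \subset S) && (J \subset K)) descent_count K L =
   \sum_(K : {set gT} | (K \subset S) && (K \subset L)) support_count J K)%N.
Proof.
move=> sJS sLS.
have := @sum_fibers _ <<L>>%g (descR S) (fun K => (K \subset S) && (J \subset K)) (fun=> 1%N).
have := @sum_fibers _ (min_reps S J) (fun a => support S a :|: J)
  (fun K => (K \subset S) && (K \subset L)) (fun=> 1%N).
under [in X in _ = X -> _]eq_bigr do rewrite muln1.
under [in X in _ -> _ = X -> _]eq_bigr do rewrite muln1.
rewrite /descent_count /support_count => <- <-.
have [sJL|nJL] := boolP (J \subset L); last first.
  rewrite [LHS]big_pred0 ?[RHS]big_pred0 // => x.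
    by apply: contraNF nJL => /and3P[_ _]; rewrite subUset => /andP[].
  by apply: contraNF nJL => /and3P[Lx _ /subset_trans]; apply; exact: descR_parabolic.
have [g Jg ng] := ex_longest sJS; have Lg := subsetP (genS sJL) _ Jg.
rewrite [LHS](reindex_inj (mulIg g)); apply: eq_bigl => a; rewrite /= groupMr //.
rewrite !subUset sJL sJS support_subS descR_subS support_subset //= andbT andbC.
apply: andb_id2r => _; apply/subsetP/(min_reps_root _ sJS) => [Dag s Js|pa s Js].
  have Ps : alpha s \in Phi by rewrite alpha_root ?(subsetP sJS).
  have Jc : spanned J (g^-1%g ** alpha s).
    by rewrite (spanned_parabolic _ sJS) ?groupV // spanned_alpha.
  have nag : {in J, forall r, ~~ pos ((a * g)%g ** alpha r)}.
    by move=> r /Dag/descR_neg.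
  have := neg_act sJS nag _ Jc; have := neg_act sJS ng _ Jc.
  by rewrite actM actKV act_root // pos_alpha ?(subsetP sJS) // => <- // ->.
rewrite descR_root (subsetP sJS) //= actM (pos_act sJS) ?ng // ?act_root ?alpha_root ?(subsetP sJS) //.
by rewrite (spanned_parabolic _ sJS) // spanned_alpha.
Qed.

Lemma shard_bhz_total k :
  (\sum_v iter k (kernel_step predT (fun v u => shard_le S rG Phi alpha u v : nat)) (fun=> 1) v =
   \sum_u iter k (kernel_step predT (fun u v => bhz_le S u v : nat)) (fun=> 1) u)%N.
Proof.
under eq_bigr do rewrite chains_below_shard.
under [RHS]eq_bigr do rewrite chains_above_bhz.
have sub0S := sub0set S; pose P (I : {set gT}) := I \subset S.
have [P0 PS] : P set0 /\ P S by rewrite /P sub0set subxx.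
transitivity (\sum_(K | P K) descent_count K S * parabolic_weight k K)%N.
  rewrite -sum_fibers; apply: eq_bigl => x.
  by rewrite generatedS inE /P descR_subS.
(* The lattice of subsets of [S] has bottom [set0] and top [S]; d(K,S) and f(set0,J) count the
   elements of W with descent set [K] and with support [J]. *)
rewrite (@iter_kernel_total _ P (fun J K => J \subset K) _ support_count set0) //.
- rewrite -[LHS]sum_fibers; apply: eq_big => [a|a _]; last by rewrite setU0.
  rewrite setU0 /P support_subS andbT.
  by apply/(min_reps_root _ sub0S) => s; rewrite inE.
- by move=> x _; apply: sub0set.
- exact: descent_support_count.
- exact: descent_count_diag.
exact: support_count_diag.
Qed.

End RootGeometry.

(** * Strict chains as iterated kernels and as faces of the order complex *)

Section ChainCounts.
Variables (T : finType).

Lemma card_path_cons (r : rel T) k (p : pred T) :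
  #|[set t : k.+1.-tuple T | p (thead t) && path r (thead t) (behead t)]| =
  \sum_(u | p u) #|[set t : k.-tuple T | path r u t]|.
Proof.
rewrite -sum1_card (reindex (fun ut : T * k.-tuple T => [tuple of ut.1 :: ut.2])) /=; last first.
  exists (fun t : k.+1.-tuple T => (thead t, [tuple of behead t])) => [[u t]|t] _ /=.
    by congr (_, _); apply: val_inj.
  by rewrite -tuple_eta.
under [RHS]eq_bigr do rewrite -sum1_card.
rewrite pair_big_dep /=; apply: eq_bigl => -[u t].
by rewrite !inE theadE.
Qed.

Variable le : rel T.

Lemma num_chains_sum k :
  num_chains le k.+1 = \sum_u iter k (kernel_step predT (fun u v => le u v : nat)) (fun=> 1) u.
Proof.
have card_path u : #|[set t : k.-tuple T | path (strict le) u t]| =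
    iter k (kernel_step predT (fun u v => le u v : nat)) (fun=> 1) u.
  elim: k u => [|k IHk] u /=.
    by rewrite (eq_card (B := predT)) ?card_tuple // => t; rewrite inE tuple0.
  under eq_kernel_step do rewrite -IHk.
  transitivity #|[set t : k.+1.-tuple T | strict le u (thead t)
                    && path (strict le) (thead t) (behead t)]|.
    by apply: eq_card => t; rewrite !inE [in LHS](tuple_eta t).
  rewrite card_path_cons /kernel_step [LHS](eq_bigl (fun v => (v != u) && le u v)).
    by rewrite big_mkcondr; apply: eq_bigr => v _; case: le; rewrite ?mul1n ?mul0n.
  by move=> v; rewrite /strict eq_sym.
under [RHS]eq_bigr do rewrite -card_path.
rewrite -card_path_cons; apply: eq_card => t.
by rewrite !inE [in LHS](tuple_eta t).
Qed.

Hypotheses (le_refl : reflexive le) (le_anti : antisymmetric le) (le_trans : transitive le).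

Lemma strict_trans : transitive (strict le).
Proof.
move=> y x z /andP[ne_xy xy] /andP[_ yz]; apply/andP; split; last exact: le_trans yz.
by apply: contraNneq ne_xy => eq_xz; apply/eqP/le_anti; rewrite xy eq_xz yz.
Qed.

(** A strict chain is determined by its set of entries, and sorting a face by [le] recovers the
    chain. *)
Lemma fvector_num_chains i : fvector le i = num_chains le i.+1.
Proof.
have strict_irr : irreflexive (strict le) by move=> x; rewrite /strict eqxx.
rewrite /fvector /num_chains.
rewrite -(@card_in_imset _ _ (fun t : i.+1.-tuple T => [set x in t])); last first.
  move=> t1 t2; rewrite !inE => sort1 sort2 /setP eq12; apply: val_inj.
  apply: (irr_sorted_eq strict_trans strict_irr) => // x.
  by have := eq12 x; rewrite !inE.
apply: eq_card => A; rewrite !inE; apply/andP/imsetP => [[/andP[_ /forall_inP cliqueA] /eqP cardA]|].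
  have size_sort : size (sort le (enum A)) == i.+1 by rewrite size_sort -cardE cardA.
  exists (Tuple size_sort); last by apply/setP => x; rewrite inE mem_sort mem_enum.
  rewrite inE /= (@eq_sorted _ _ [rel x y | (x != y) && le x y]) // sorted_relI.
  rewrite pairwise_sorted -?uniq_pairwise ?sort_uniq ?enum_uniq //=.
  apply: (@sort_sorted_in _ (mem A)); last by apply/allP => x; rewrite mem_enum.
  by move=> x y Ax Ay; have /forall_inP := cliqueA x Ax; apply.
case=> t; rewrite inE => sort_t ->.
have uniq_t : uniq t := sorted_uniq strict_trans strict_irr sort_t.
have sort_le : sorted le t by apply: sub_sorted sort_t => x y /andP[].
rewrite cardsE (card_uniqP uniq_t) size_tuple; split=> //; apply/andP; split.
  by apply/set0Pn; exists (thead t); rewrite inE mem_tnth.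
apply/forall_inP => x; rewrite inE => t_x; apply/forall_inP => y; rewrite inE => t_y.
have le_index := sorted_leq_index le_trans le_refl sort_le.
by case/orP: (leq_total (index x t) (index y t)) => /le_index->; rewrite ?orbT.
Qed.

End ChainCounts.

Theorem theorem1p2 (R : realType) (gT : finGroupType) (S : {set gT}) (n : nat)
    (rG : mx_representation R [set: gT]%G n)
    (Phi : seq 'cV[R]_n) (alpha : gT -> 'cV[R]_n)
    (coxS : coxeter_system S) (rootPhi : root_system S rG Phi alpha) :
  (forall i : nat,
     fvector (shard_le S rG Phi alpha) i = fvector (bhz_le S) i) /\
  (forall k : nat, (1 <= k)%N ->
     num_chains (shard_le S rG Phi alpha) k = num_chains (bhz_le S) k).
Proof.
have [gen_S _ _] := coxS.
have chains k : num_chains (shard_le S rG Phi alpha) k.+1 = num_chains (bhz_le S) k.+1.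
  rewrite !num_chains_sum -(shard_bhz_total gen_S rootPhi).
  (* [num_chains_sum] builds chains from the bottom, whereas [shard_bhz_total] builds the shard
     chains from the top; adjointness reconciles the two. *)
  have := iter_kernel_adjoint predT k (fun v u => shard_le S rG Phi alpha u v : nat)
    (fun=> 1) (fun=> 1).
  under eq_bigr do rewrite muln1.
  by under [X in _ = X -> _]eq_bigr do rewrite mul1n.
split=> [i|[|k] //]; rewrite !fvector_num_chains //.
- exact: bhz_le_refl gen_S rootPhi.
- exact: bhz_le_anti gen_S rootPhi.
- exact: bhz_le_trans gen_S rootPhi.
- exact: shard_le_refl.
- exact: shard_le_anti gen_S rootPhi.
exact: shard_le_trans.
Qed.
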